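(* Let $\gamma_1,\dots,\gamma_g$ be free generators, in good position, of a Schottky group $\Gamma\le PGL(2,K)$, with a corresponding good fundamental domain $F=\mathbb{P}^1\setminus(B_1\cup\dots\cup B_g\cup B_1'\cup\dots\cup B_g')$ such that $\infty$ lies in the interior of $F$. Let $c$ be the minimum pairwise distance in $(\mathbb{P}^1)^{an}$ between the points $P_1,\dots,P_g,P_1',\dots,P_g'$ corresponding to $B_1^+,\dots,B_g^+,B_1'^+,\dots,B_g'^+$, and let $d$ be the minimum diameter of $B_1,\dots,B_g,B_1',\dots,B_g'$. Let $m\ge1$ be an integer, $1\le i\le g$, $a\in B_i'^+\setminus B_i'$, and $z\in F\cap K$ with $z\notin\Gamma a$. Then $$\left|\sum_{\gamma\in\Gamma_m}\frac{\gamma a-\gamma\gamma_i a}{(z-\gamma a)(z-\gamma\gamma_i a)}-\frac{u_{\gamma_i}'(z)}{u_{\gamma_i}(z)}\right|\le p^{-mc-\log_p(d)}.$$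
   Context: $K=\mathbb{C}_p$ is the completion of an algebraic closure of $\mathbb{Q}_p$, with norm normalized by $|p|=1/p$, and $\mathbb{P}^1=\mathbb{P}^1(K)=K\cup\{\infty\}$, on which $PGL(2,K)$ acts by fractional linear transformations. Schottky groups: a $2\times2$ matrix is hyperbolic if it has two eigenvalues with different valuations. A Schottky group is a finitely generated subgroup $\Gamma\le PGL(2,K)$ all of whose non-identity elements are hyperbolic; such a group is free. With respect to free generators, each $\gamma\in\Gamma$ has a unique reduced word $h_1\cdots h_k$ with $h_l\in\{\gamma_1^{\pm1},\dots,\gamma_g^{\pm1}\}$, $h_l\ne h_{l+1}^{-1}$; $\Gamma_m$ is the set of elements whose reduced word has length at most $m$. $\Sigma\subset\mathbb{P}^1$ is the set of fixed points of non-identity elements of $\Gamma$ together with the limit points of these fixed points, and $\Omega=\mathbb{P}^1\setminus\Sigma$. Balls: $B(a,r)=\{x\in K:|x-a|<r\}$, $B(a,r)^+=\{x\in K:|x-a|\le r\}$. An open ball in $\mathbb{P}^1$ is some $B(a,r)$ or some $\mathbb{P}^1\setminus B(a,r)^+$; the corresponding closed ball $B^+$ is $B(a,r)^+$, respectively $\mathbb{P}^1\setminus B(a,r)$. The diameter of $B(a,r)$ is $r$. A good fundamental domain corresponding to $\gamma_1,\dots,\gamma_g$ is $F=\mathbb{P}^1\setminus(B_1\cup\dots\cup B_g\cup B_1'\cup\dots\cup B_g')$ with $B_i,B_i'$ open balls such that the $2g$ corresponding closed balls are pairwise disjoint and $\gamma_i(\mathbb{P}^1\setminus B_i')=B_i^+$,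 $\gamma_i^{-1}(\mathbb{P}^1\setminus B_i)=B_i'^+$ for all $i$. Its interior is $F^\circ=\mathbb{P}^1\setminus\bigcup_i(B_i^+\cup B_i'^+)$. The generators are in good position if such a domain exists. Each closed ball $B(a,r)^+$, $r>0$, determines a point of $(\mathbb{P}^1)^{an}$. If $B(a_1,r_1)^+\subseteq B(a_2,r_2)^+$ determine $P_1,P_2$, then $d(P_1,P_2)=\log_p(r_2/r_1)$; in general $d(P_1,P_2)=d(P_1,P_3)+d(P_3,P_2)$, where $P_3$ is determined by the smallest closed ball $B(a_3,r_3)^+$ containing both. For $\alpha\in\Gamma$, $u_\alpha(z)=\prod_{\gamma\in\Gamma}\frac{z-\gamma b}{z-\gamma\alpha b}$ for any $b\in\Omega$; this function is independent of the choice of $b$, and $u_\alpha'$ denotes its derivative in $z$. *)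

(* Defs.v *)
From HB Require Import structures.
From mathcomp Require Import all_boot all_order all_fingroup all_algebra.
From mathcomp Require Import generic_quotient finmap.
From mathcomp Require Import all_classical all_reals all_analysis.

Set Implicit Arguments.
Unset Strict Implicit.
Unset Printing Implicit Defensive.

Import Order.TTheory GRing.Theory Num.Theory.

Local Open Scope classical_set_scope.
Local Open Scope ring_scope.

Section Cp.
Variables (R : realType) (p : nat) (K : fieldType) (norm : K -> R).

(* Inside a complete K, the completion Q_p of Q is the closure of the prime
   field. *)
Definition Qp : set K :=
  [set x | forall e : R, 0 < e -> exists q : rat, norm (x - ratr q) < e].

Definition Qpbar : set K :=
  [set x | exists q : {poly K},
     [/\ q != 0, (forall i, Qp q`_i) & root q x]].

(* [is_Cp p norm]: (K, norm) is the completion of an algebraic closure of Q_p,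
   normalized by |p| = 1/p; this determines (K, norm) up to isometric
   isomorphism.  That norm restricts to the p-adic absolute value on Q follows
   from multiplicativity, the ultrametric inequality and |p| = 1/p < 1. *)
Record is_Cp : Prop := IsCp {
  Cp_norm_ge0 : forall x, 0 <= norm x;
  Cp_norm_eq0 : forall x, norm x = 0 <-> x = 0;
  Cp_normM : forall x y, norm (x * y) = norm x * norm y;
  Cp_normD : forall x y, norm (x + y) <= Num.max (norm x) (norm y);
  Cp_normp : norm p%:R = p%:R^-1;
  Cp_complete : forall u : nat -> K,
    (forall e : R, 0 < e -> exists N : nat,
       forall k l, (N <= k)%N -> (N <= l)%N -> norm (u k - u l) < e) ->
    exists x : K, forall e : R, 0 < e -> exists N : nat,
      forall k, (N <= k)%N -> norm (u k - x) < e;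
  Cp_Qpbar_closed : forall q : {poly K}, (1 < size q)%N ->
    (forall i, Qpbar q`_i) -> exists2 x, Qpbar x & root q x;
  Cp_Qpbar_dense : forall (x : K) (e : R), 0 < e ->
    exists2 y, Qpbar y & norm (x - y) < e
}.

End Cp.

Definition GL2 (K : fieldType) := {A : 'M[K]_2 | A \in unitmx}.
HB.instance Definition _ (K : fieldType) := SubChoice.on (GL2 K).

Definition mkGL2 (K : fieldType) (A : 'M[K]_2) (hA : A \in unitmx) : GL2 K :=
  exist _ A hA.

Section PGL2.
Variable K : fieldType.
Implicit Types A B C : GL2 K.

Definition projeq A B := `[< exists2 c : K, c != 0 & val B = c *: val A >].

Lemma projeqP A B :
  reflect (exists2 c : K, c != 0 & val B = c *: val A) (projeq A B).
Proof. exact: asboolP. Qed.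

Lemma projeq_refl : reflexive projeq.
Proof. by move=> A; apply/projeqP; exists 1; rewrite ?oner_eq0 ?scale1r. Qed.

Lemma projeq_sym : symmetric projeq.
Proof.
suff h A B : projeq A B -> projeq B A by move=> A B; apply/idP/idP; exact: h.
move=> /projeqP[c c0 AB]; apply/projeqP; exists c^-1; first by rewrite invr_eq0.
by rewrite AB scalerA mulVf // scale1r.
Qed.

Lemma projeq_trans : transitive projeq.
Proof.
move=> B A C /projeqP[c c0 AB] /projeqP[d d0 BC]; apply/projeqP.
by exists (d * c); rewrite ?mulf_neq0 // BC AB scalerA.
Qed.

Canonical projeq_equiv := EquivRel projeq projeq_refl projeq_sym projeq_trans.

Definition PGL2 := {eq_quot projeq}%qT.
HB.instance Definition _ := Choice.on PGL2.
HB.instance Definition _ := EqQuotient.on PGL2.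

Definition GL2_one : GL2 K := mkGL2 (unitmx1 K 2).

Lemma GL2_mul_subproof A B : val A *m val B \in unitmx.
Proof. by rewrite unitmx_mul (valP A) (valP B). Qed.
Definition GL2_mul A B : GL2 K := mkGL2 (GL2_mul_subproof A B).

Lemma GL2_inv_subproof A : invmx (val A) \in unitmx.
Proof. by rewrite unitmx_inv (valP A). Qed.
Definition GL2_inv A : GL2 K := mkGL2 (GL2_inv_subproof A).

Definition PGL2_one : PGL2 := (\pi_PGL2 GL2_one)%qT.
Definition PGL2_mul (x y : PGL2) : PGL2 :=
  (\pi_PGL2 (GL2_mul (repr x) (repr y)))%qT.
Definition PGL2_inv (x : PGL2) : PGL2 := (\pi_PGL2 (GL2_inv (repr x)))%qT.

Lemma PGL2_eqP A B :
  (\pi_PGL2 A = \pi_PGL2 B)%qT <-> exists2 c : K, c != 0 & val B = c *: val A.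
Proof.
split; first by move=> /eqP; rewrite piE => /projeqP.
by move=> h; apply/eqP; rewrite piE; apply/projeqP.
Qed.

Lemma repr_pi_GL2 A :
  exists2 c : K, c != 0 & val A = c *: val (repr (\pi_PGL2 A)%qT).
Proof. by apply/PGL2_eqP; rewrite reprK. Qed.

Lemma PGL2_mul_pi A B :
  PGL2_mul (\pi_PGL2 A)%qT (\pi_PGL2 B)%qT = (\pi_PGL2 (GL2_mul A B))%qT.
Proof.
apply/PGL2_eqP; have [c c0 Ac] := repr_pi_GL2 A.
have [d d0 Bd] := repr_pi_GL2 B.
exists (c * d); rewrite ?mulf_neq0 //= [in LHS]Ac [in LHS]Bd.
by rewrite -scalemxAl -scalemxAr scalerA.
Qed.

Lemma PGL2_inv_pi A : PGL2_inv (\pi_PGL2 A)%qT = (\pi_PGL2 (GL2_inv A))%qT.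
Proof.
apply/PGL2_eqP; have [c c0 Ac] := repr_pi_GL2 A.
exists c^-1; rewrite ?invr_eq0 //= [in LHS]Ac invmxZ //.
by rewrite -Ac (valP A).
Qed.

Lemma pi_GL2_val A B : val A = val B -> \pi_PGL2%qT A = \pi_PGL2%qT B.
Proof. by move=> AB; apply/PGL2_eqP; exists 1; rewrite ?oner_eq0 ?scale1r. Qed.

Lemma PGL2_mulA : associative PGL2_mul.
Proof.
elim/quotW=> A; elim/quotW=> B; elim/quotW=> C.
rewrite (PGL2_mul_pi B C) (PGL2_mul_pi A B) !PGL2_mul_pi.
by apply: pi_GL2_val; rewrite /= mulmxA.
Qed.

Lemma PGL2_mul1 : left_id PGL2_one PGL2_mul.
Proof.
elim/quotW=> A; rewrite PGL2_mul_pi.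
by apply: pi_GL2_val; rewrite /= mul1mx.
Qed.

Lemma PGL2_1mul : right_id PGL2_one PGL2_mul.
Proof.
elim/quotW=> A; rewrite PGL2_mul_pi.
by apply: pi_GL2_val; rewrite /= mulmx1.
Qed.

Lemma PGL2_mulV : left_inverse PGL2_one PGL2_inv PGL2_mul.
Proof.
elim/quotW=> A; rewrite PGL2_inv_pi PGL2_mul_pi.
by apply: pi_GL2_val; rewrite /= mulVmx // (valP A).
Qed.

Lemma PGL2_Vmul : right_inverse PGL2_one PGL2_inv PGL2_mul.
Proof.
elim/quotW=> A; rewrite PGL2_inv_pi PGL2_mul_pi.
by apply: pi_GL2_val; rewrite /= mulmxV // (valP A).
Qed.

HB.instance Definition _ :=
  isGroup.Build PGL2 PGL2_mulA PGL2_mul1 PGL2_1mul PGL2_mulV PGL2_Vmul.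

(* None is the point at infinity. *)
Definition P1 := option K.

Definition mobius (A : 'M[K]_2) (x : P1) : P1 :=
  let a := A 0 0 in let b := A 0 1 in let c := A 1 0 in let d := A 1 1 in
  match x with
  | Some z => if c * z + d == 0 then None else Some ((a * z + b) / (c * z + d))
  | None => if c == 0 then None else Some (a / c)
  end.

Definition pgl_act (x : PGL2) : P1 -> P1 := mobius (val (repr x)).

Lemma mobiusZ (c : K) (A : 'M[K]_2) : c != 0 -> mobius (c *: A) =1 mobius A.
Proof.
move=> c0 [z|]; rewrite /mobius !mxE.
  rewrite -!mulrA -!mulrDr mulf_eq0 (negPf c0) /=.
  by case: ifP => // _; congr Some; rewrite -mulf_div divff // mul1r.
rewrite mulf_eq0 (negPf c0) /=.
by case: ifP => // _; congr Some; rewrite -mulf_div divff // mul1r.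
Qed.

Lemma pgl_act_pi A : pgl_act (\pi_PGL2 A)%qT =1 mobius (val A).
Proof. by have [c c0 ->] := repr_pi_GL2 A => x; rewrite mobiusZ. Qed.

(* Affine coordinate; the value at infinity is a placeholder. *)
Definition aff (x : P1) : K := odflt 0 x.

End PGL2.

Section Groups.
Variables (R : realType) (K : fieldType) (norm : K -> R).

Definition hyperbolic_mx (A : 'M[K]_2) :=
  exists l1 l2 : K,
    [/\ eigenvalue A l1, eigenvalue A l2 & norm l1 != norm l2].

(* Independent of the representative when norm is an absolute value. *)
Definition hyperbolic (x : PGL2 K) := hyperbolic_mx (val (repr x)).

Definition is_subgroup (H : set (PGL2 K)) := group_closed (mem H).

Definition gen_by (A : set (PGL2 K)) : set (PGL2 K) := smallest is_subgroup A.

Definition schottky (Gamma : set (PGL2 K)) :=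
  [/\ is_subgroup Gamma,
      (exists n (s : 'I_n -> PGL2 K), gen_by (range s) = Gamma)
    & (forall x, Gamma x -> x <> 1%g -> hyperbolic x)].

Variable g : nat.

(* The letter (i, false) stands for gamma_i and (i, true) for gamma_i^-1. *)
Definition letter := ('I_g * bool)%type.
Definition letter_inv (l : letter) : letter := (l.1, ~~ l.2).
Definition reduced (w : seq letter) :=
  sorted (fun h h' => h != letter_inv h') w.

Definition letter_val (gamma : 'I_g -> PGL2 K) (l : letter) : PGL2 K :=
  if l.2 then (gamma l.1)^-1%g else gamma l.1.
Definition word_val (gamma : 'I_g -> PGL2 K) (w : seq letter) : PGL2 K :=
  (\prod_(l <- w) letter_val gamma l)%g.

Definition free_generators (Gamma : set (PGL2 K)) (gamma : 'I_g -> PGL2 K) :=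
  gen_by (range gamma) = Gamma /\
  forall w1 w2, reduced w1 -> reduced w2 ->
    word_val gamma w1 = word_val gamma w2 -> w1 = w2.

(* The set Gamma_m, for Gamma freely generated by gamma. *)
Definition words_le (gamma : 'I_g -> PGL2 K) (m : nat) : set (PGL2 K) :=
  [set x | exists w, [/\ reduced w, (size w <= m)%N & word_val gamma w = x]].

Definition Gorbit (Gamma : set (PGL2 K)) (x : P1 K) : set (P1 K) :=
  [set pgl_act y x | y in Gamma].

End Groups.

Section Balls.
Variables (R : realType) (K : fieldType) (norm : K -> R).

(* Disc a r encodes the open ball B(a,r), and CoDisc a r encodes the open ball
   which is the complement of B(a,r)^+. *)
Inductive oball := Disc of K & R | CoDisc of K & R.

Definition bcenter (B : oball) : K :=
  match B with Disc a _ | CoDisc a _ => a end.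
(* For a ball B(a,r), this is its diameter. *)
Definition bradius (B : oball) : R :=
  match B with Disc _ r | CoDisc _ r => r end.

Definition ballo (a : K) (r : R) : set (P1 K) :=
  [set Some x | x in [set x | norm (x - a) < r]].
Definition ballc (a : K) (r : R) : set (P1 K) :=
  [set Some x | x in [set x | norm (x - a) <= r]].

Definition opn (B : oball) : set (P1 K) :=
  match B with Disc a r => ballo a r | CoDisc a r => ~` ballc a r end.
Definition cls (B : oball) : set (P1 K) :=
  match B with Disc a r => ballc a r | CoDisc a r => ~` ballo a r end.

Definition limit_points (A : set (P1 K)) : set (P1 K) :=
  [set x | forall B : oball, 0 < bradius B -> opn B x ->
     exists y, [/\ A y, y <> x & opn B y]].

Definition fixed_points (Gamma : set (PGL2 K)) : set (P1 K) :=
  [set x | exists y, [/\ Gamma y, y <> 1%g & pgl_act y x = x]].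

Definition Sigma (Gamma : set (PGL2 K)) : set (P1 K) :=
  fixed_points Gamma `|` limit_points (fixed_points Gamma).
Definition Omega (Gamma : set (PGL2 K)) : set (P1 K) := ~` Sigma Gamma.

Variable g : nat.

Definition sides (B B' : 'I_g -> oball) (s : 'I_g + 'I_g) : oball :=
  match s with inl i => B i | inr i => B' i end.

Definition fdomain (B B' : 'I_g -> oball) : set (P1 K) :=
  ~` \bigcup_s opn (sides B B' s).
Definition fdomain_int (B B' : 'I_g -> oball) : set (P1 K) :=
  ~` \bigcup_s cls (sides B B' s).

Definition good_fdomain (gamma : 'I_g -> PGL2 K) (B B' : 'I_g -> oball) :=
  [/\ forall s, 0 < bradius (sides B B' s),
      trivIset setT (fun s => cls (sides B B' s)),
      forall i, pgl_act (gamma i) @` (~` opn (B' i)) = cls (B i)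
    & forall i, pgl_act (gamma i)^-1%g @` (~` opn (B i)) = cls (B' i)].

End Balls.

Section Distance.
Variables (R : realType) (p : nat) (K : fieldType) (norm : K -> R).

Definition logp (x : R) : R := ln x / ln p%:R.

(* The pair (a, r), with r > 0, encodes the point of the Berkovich projective
   line determined by B(a,r)^+. *)
Definition bpoint := (K * R)%type.
(* The point determined by the closed ball of a ball B(a,r). *)
Definition bpt (B : oball R K) : bpoint := (bcenter B, bradius B).
Definition bset (P : bpoint) : set (P1 K) := ballc norm P.1 P.2.

(* The smallest closed ball containing two given ones, see [bjoinP]. *)
Definition bjoin (P Q : bpoint) : bpoint :=
  (P.1, Num.max (norm (P.1 - Q.1)) (Num.max P.2 Q.2)).

Definition bdist (P Q : bpoint) : R :=
  logp ((bjoin P Q).2 / P.2) + logp ((bjoin P Q).2 / Q.2).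

Lemma bjoinP (P Q : bpoint) : is_Cp p norm -> 0 < P.2 -> 0 < Q.2 ->
  [/\ bset P `<=` bset (bjoin P Q), bset Q `<=` bset (bjoin P Q)
    & forall T, bset P `<=` bset T -> bset Q `<=` bset T ->
        bset (bjoin P Q) `<=` bset T].
Proof.
case: P Q => [a r] [b s] hK /= r0 s0.
have n0 : norm 0 = 0 by apply/(Cp_norm_eq0 hK).
have nN x : norm (- x) = norm x.
  have n1 : norm 1 = 1.
    have n1n0 : norm 1 != 0.
      by apply/eqP => /(Cp_norm_eq0 hK)/eqP; rewrite oner_eq0.
    by apply: (mulfI n1n0); rewrite -(Cp_normM hK) !mulr1.
  have nm1 : norm (-1) = 1.
    have : norm (-1) ^+ 2 = 1 by rewrite expr2 -(Cp_normM hK) mulrNN mulr1.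
    by move=> /eqP; rewrite sqrp_eq1 ?(Cp_norm_ge0 hK) // => /eqP.
  by rewrite -mulN1r (Cp_normM hK) nm1 mul1r.
have nB x y z (t : R) :
    norm (x - y) <= t -> norm (y - z) <= t -> norm (x - z) <= t.
  move=> xy yz; rewrite -(subrK y x) -addrA.
  by apply: le_trans (Cp_normD hK _ _) _; rewrite ge_max xy yz.
split.
- by move=> _ [x /= xa <-]; exists x => //=; rewrite !le_max xa orbT.
- move=> _ [x /= xb <-]; exists x => //=; apply: (nB _ b).
    by rewrite !le_max xb !orbT.
  by rewrite -nN opprB le_max lexx.
move=> [t u] /= hP hQ _ [x /= xj <-]; exists x => //=.
have a_t : norm (a - t) <= u.
  have [|? ? [<-]] // := hP (Some a).
  by exists a => //=; rewrite subrr n0 ltW.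
have b_t : norm (b - t) <= u.
  have [|? ? [<-]] // := hQ (Some b).
  by exists b => //=; rewrite subrr n0 ltW.
have a_b : norm (a - b) <= u by apply: (nB _ t) => //; rewrite -nN opprB.
move: xj; rewrite !le_max => /or3P[xab|xar|xas].
- by apply: (nB _ a) => //; exact: le_trans xab _.
- by have [|? ? [<-]] := hP (Some x); first by exists x.
have [abs|/ltW sab] := leP (norm (a - b)) s.
  have [|? ? [<-]] // := hQ (Some x).
  by exists x => //=; exact: (nB _ a).
apply: (nB _ a) => //; exact: le_trans (le_trans xas sab) a_b.
Qed.

End Distance.

Section Automorphic.
Variables (R : realType) (K : fieldType) (norm : K -> R).

(* z - x, with the usual convention that z - oo stands for 1: when gamma b = oo
   for some gamma, oo occurs once in a numerator and once in a denominator of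
   the product defining u_alpha (if alpha != 1), and these factors cancel in
   the limit. *)
Definition zsub (z : K) (x : P1 K) : K := if x is Some y then z - y else 1.

(* v is the product of the f x, for x in A: unconditional convergence along
   the finite subsets of A. *)
Definition has_prod (T : choiceType) (A : set T) (f : T -> K) (v : K) :=
  forall e : R, 0 < e ->
    exists2 S0 : {fset T}, [set` S0] `<=` A &
      forall S : {fset T}, (S0 `<=` S)%fset -> [set` S] `<=` A ->
        norm (\prod_(x <- S) f x - v) < e.

(* The common value at z of the products, for b in Omega. The points b with
   z \in Gamma b are left out, as two factors would then be z - z = 0, one in a
   numerator and one in a denominator. *)
Definition u_ (Gamma : set (PGL2 K)) (alpha : PGL2 K) (z : K) : K :=
  xget 0 [set v | forall b : P1 K, Omega norm Gamma b ->
    ~ Gorbit Gamma b (Some z) ->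
    has_prod Gamma
      (fun y => zsub z (pgl_act y b) / zsub z (pgl_act (y * alpha)%g b)) v].

Definition is_derivative (f : K -> K) (z l : K) :=
  forall e : R, 0 < e -> exists2 r : R, 0 < r &
    forall h : K, h != 0 -> norm h < r ->
      norm ((f (z + h) - f z) / h - l) < e.

Definition derivative (f : K -> K) (z : K) : K :=
  xget 0 [set l | is_derivative f z l].

End Automorphic.

Definition is_min (R : realType) (A : set R) (x : R) := A x /\ lbound A x.

(* Main.v *)
Require Import Defs.
From mathcomp Require Import all_boot all_order all_fingroup all_algebra.
From mathcomp Require Import generic_quotient finmap.
From mathcomp Require Import all_classical all_reals all_analysis.
From mathcomp Require Import ring.

(* Since infinity lies in the interior of F, the 2g balls are discs, one disc D_l
   for each letter l, and l maps the complement of D_(l^-1) onto D_l^+.  In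
   coordinates l(w) = e + k / (w - q) with |k| = rad l * rad l^-1, so l contracts
   D_h^+, for h <> l^-1, by the factor (rad l / rad h) p^-c.  Hence a reduced word
   h_1 ... h_k maps F into D_(h_1)^+ with diameter at most
   rad h_1 * p^(-(k-1)c).

   Consequences: |y b - y b'| tends to 0 along Gamma for b, b' in Gamma F, F
   contains no fixed point and, the attracting fixed points of letters being
   carried into nested sequences of discs, Omega is contained in Gamma F.  So the
   products defining u converge, to a value independent of b; taking b = a and
   differentiating the product gives u'/u as the sum over all of Gamma.  The
   terms outside Gamma_m have numerator at most rad l * p^(-mc) and denominator
   at least (rad l)^2 for the first letter l, and rad l >= d. *)

Set Implicit Arguments.
Unset Strict Implicit.
Unset Printing Implicit Defensive.

Import Order.TTheory GRing.Theory Num.Theory.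

Local Open Scope classical_set_scope.
Local Open Scope ring_scope.

(** * Ultrametric absolute values *)

Section Ultrametric.
Variables (R : realType) (p : nat) (K : fieldType) (norm : K -> R).
Hypotheses (hp : prime p) (hK : is_Cp p norm).

Lemma norm_ge0 x : 0 <= norm x. Proof. exact: Cp_norm_ge0 hK x. Qed.

Lemma normM x y : norm (x * y) = norm x * norm y.
Proof. exact: Cp_normM hK x y. Qed.

Lemma norm0 : norm 0 = 0. Proof. exact/(Cp_norm_eq0 hK). Qed.

Lemma norm_eq0 x : (norm x == 0) = (x == 0).
Proof. by apply/eqP/eqP => /(Cp_norm_eq0 hK). Qed.

Lemma norm_gt0 x : (0 < norm x) = (x != 0).
Proof. by rewrite lt_def norm_eq0 norm_ge0 andbT. Qed.

Lemma norm1 : norm 1 = 1.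
Proof.
have n1 : norm 1 != 0 by rewrite norm_eq0 oner_eq0.
by apply: (mulfI n1); rewrite -normM !mulr1.
Qed.

Lemma normN x : norm (- x) = norm x.
Proof.
have nm1 : norm (-1) = 1.
  have : norm (-1) ^+ 2 = 1 by rewrite expr2 -normM mulrNN mulr1 norm1.
  by move=> /eqP; rewrite sqrp_eq1 ?norm_ge0 // => /eqP.
by rewrite -mulN1r normM nm1 mul1r.
Qed.

Lemma normV x : norm x^-1 = (norm x)^-1.
Proof.
have [->|x0] := eqVneq x 0; first by rewrite invr0 norm0 invr0.
have nx : norm x != 0 by rewrite norm_eq0.
by apply: (mulfI nx); rewrite -normM !divff // norm1.
Qed.

Lemma normX x n : norm (x ^+ n) = norm x ^+ n.
Proof. by elim: n => [|n IH]; rewrite ?expr0 ?norm1 // !exprS normM IH. Qed.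

Lemma normC x y : norm (x - y) = norm (y - x).
Proof. by rewrite -normN opprB. Qed.

Lemma norm_le x y t : norm x <= t -> norm y <= t -> norm (x + y) <= t.
Proof.
by move=> xt yt; apply: le_trans (Cp_normD hK _ _) _; rewrite ge_max xt.
Qed.

Lemma norm_lt x y t : norm x < t -> norm y < t -> norm (x + y) < t.
Proof.
by move=> xt yt; apply: le_lt_trans (Cp_normD hK _ _) _; rewrite gt_max xt.
Qed.

Lemma dist_le y x z t : norm (x - y) <= t -> norm (y - z) <= t ->
  norm (x - z) <= t.
Proof. by move=> xy yz; rewrite -(subrK y x) -addrA norm_le. Qed.

Lemma dist_lt y x z t : norm (x - y) < t -> norm (y - z) < t ->
  norm (x - z) < t.
Proof. by move=> xy yz; rewrite -(subrK y x) -addrA norm_lt. Qed.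

(** Were [x + y] smaller than [x], then [x = (x + y) - y] would be smaller than itself. *)
Lemma normDl x y : norm y < norm x -> norm (x + y) = norm x.
Proof.
move=> yx; apply/eqP; rewrite eq_le norm_le ?(ltW yx) //=.
rewrite leNgt; apply/negP => xyx.
have : norm (x + y - y) < norm x by apply: norm_lt; rewrite ?normN.
by rewrite addrK ltxx.
Qed.

Lemma norm_near x y : norm (y - x) < norm x -> norm y = norm x.
Proof. by move=> /normDl; rewrite subrKC. Qed.

Lemma norm_sum (I : Type) (s : seq I) (P : pred I) (f : I -> K) t : 0 <= t ->
  (forall i, P i -> norm (f i) <= t) -> norm (\sum_(i <- s | P i) f i) <= t.
Proof.
move=> t0 ft; elim/big_ind: _ => [|x y|//]; first by rewrite norm0.
exact: norm_le.
Qed.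

(** * The value group *)

Lemma p_gt1 : 1 < p%:R :> R. Proof. by rewrite ltr1n prime_gt1. Qed.

Lemma p_neq0 : p%:R != 0 :> K.
Proof.
rewrite -norm_eq0 (Cp_normp hK) invr_eq0 pnatr_eq0 -lt0n; exact: prime_gt0.
Qed.

Lemma norm_small (e : R) : 0 < e -> exists2 x : K, x != 0 & norm x < e.
Proof.
move=> e0; have pi1 : `|(p%:R : R)^-1| < 1.
  by rewrite ger0_norm ?invr_ge0 ?ler0n // invf_lt1 ?p_gt1 // (lt_trans ltr01 p_gt1).
have /cvgrPdist_lt/(_ e e0)[N _ /(_ N (leqnn N))] := cvg_expr pi1.
rewrite /= distrC subr0 => pN; exists (p%:R ^+ N); first by rewrite expf_neq0 ?p_neq0.
by rewrite normX (Cp_normp hK) -(ger0_norm (x := _ ^+ N)) // exprn_ge0 // invr_ge0 ler0n.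
Qed.

(* The roots of [X^n - p] have norm [p^(-1/n)]. *)
Lemma norm_root n : exists x : K, norm x ^+ n.+1 = p%:R^-1.
Proof.
have QpC (q : int) : Qp norm q%:~R.
  by move=> e e0; exists q%:~R; rewrite ratr_int subrr norm0.
have QbC (q : int) : Qpbar norm q%:~R.
  exists ('X - (q%:~R)%:P); split; first by rewrite polyXsubC_eq0.
  - move=> [|[|k]]; rewrite coefB coefX coefC /= ?subr0 ?sub0r ?oppr0.
    + by rewrite -rmorphN; exact: QpC.
    + by have := QpC 1; rewrite rmorph1.
    + by have := QpC 0; rewrite rmorph0.
  - by rewrite root_XsubC.
have [|k|x _ /rootP] := @Cp_Qpbar_closed _ _ _ _ hK ('X^(n.+1) - p%:R%:P).
- by rewrite size_XnsubC.
- rewrite coefB coefXn coefC.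
  suff -> : (k == n.+1)%:R - (if k == 0%N then p%:R else 0) =
    ((k == n.+1)%:R - (if k == 0%N then p%:R else 0) : int)%:~R :> K by exact: QbC.
  by rewrite rmorphB /= rmorph_nat; case: (k == 0%N); rewrite ?rmorph_nat ?rmorph0.
rewrite hornerD hornerN hornerXn hornerC => /eqP; rewrite subr_eq0 => /eqP xp.
by exists x; rewrite -normX xp (Cp_normp hK).
Qed.

(** A root of [X^(n+1) - p] has norm below 1 and, for [n] large, above [s / t]. When an element of
    norm above [t] is multiplied by it repeatedly, the first product of norm at most [t] cannot jump
    past [s]. *)
Lemma norm_dense (s t : R) : 0 < s -> s < t ->
  exists2 x : K, s < norm x & norm x <= t.
Proof.
move=> s0 st; have t0 := lt_trans s0 st.
have pV0 : 0 < (p%:R : R)^-1 by rewrite invr_gt0 (lt_trans ltr01 p_gt1).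
have pV1 : (p%:R : R)^-1 < 1.
  by rewrite invf_lt1 ?p_gt1 // (lt_trans ltr01 p_gt1).
have expr_small (u e : R) : 0 <= u -> u < 1 -> 0 < e -> exists n, u ^+ n < e.
  move=> u0 u1 e0; have u1' : `|u| < 1 by rewrite ger0_norm.
  have /cvgrPdist_lt/(_ e e0)[N _ /(_ N (leqnn N))] := cvg_expr u1'.
  by rewrite /= distrC subr0 ger0_norm ?exprn_ge0 // => uN; exists N.
have st1 : s / t < 1 by rewrite ltr_pdivrMr // mul1r.
have st0 : 0 < s / t by exact: divr_gt0.
have [n stn] := expr_small _ _ (ltW st0) st1 pV0.
have [x xn] := norm_root n.
have x1 : norm x < 1.
  by rewrite -(@expr_lt1 _ n.+1) ?norm_ge0 // xn.
have stx : s / t < norm x.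
  rewrite -(@ltr_pXn2r _ n.+1) ?nnegrE ?norm_ge0 ?(ltW st0) // xn exprS.
  apply: le_lt_trans stn; apply: ler_piMl _ (ltW st1).
  by rewrite exprn_ge0 // ltW.
have x0 : 0 < norm x by exact: lt_trans stx.
have [y y0 yt] : exists2 y : K, y != 0 & norm y < t^-1.
  by apply: norm_small; rewrite invr_gt0.
have yt' : t < norm y^-1.
  by rewrite normV -ltf_pV2 ?posrE ?invr_gt0 ?norm_gt0 // invrK.
have exk : exists k, norm (y^-1 * x ^+ k) <= t.
  have ty : 0 < t * norm y by rewrite mulr_gt0 // norm_gt0.
  have [k xk] := expr_small _ _ (norm_ge0 x) x1 ty; exists k.
  by rewrite normM normV normX ler_pdivrMl ?norm_gt0 // mulrC ltW.
case: (ex_minnP exk) => -[|k] kt kmin.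
  by move: kt; rewrite expr0 mulr1 leNgt yt'.
exists (y^-1 * x ^+ k.+1) => //.
have : ~~ (norm (y^-1 * x ^+ k) <= t) by apply/negP => /kmin; rewrite ltnn.
rewrite -ltNge => tk; rewrite exprSr mulrA normM.
apply: (@lt_le_trans _ _ (t * norm x)).
  by rewrite mulrC -ltr_pdivrMr.
by rewrite ler_pM2r // ltW.
Qed.

End Ultrametric.

(** * Limits along finite subsets *)

Section FiniteSubsets.
Variables (R : realType) (p : nat) (K : fieldType) (norm : K -> R).
Hypotheses (hp : prime p) (hK : is_Cp p norm).
Variables (T : choiceType) (A : set T).
Implicit Types (P Q : {fset T} -> Prop) (Phi Psi : {fset T} -> K).

Definition eventually P := exists2 S0 : {fset T}, [set` S0] `<=` A &
  forall S : {fset T}, (S0 `<=` S)%fset -> [set` S] `<=` A -> P S.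

(** For finite products this unfolds to [has_prod], so the rules for limits below apply to infinite
    products as well. *)
Definition has_lim Phi (v : K) :=
  forall e : R, 0 < e -> eventually (fun S => norm (Phi S - v) < e).

Definition tends (f : T -> K) (v : K) := forall e : R, 0 < e ->
  exists2 S0 : {fset T}, [set` S0] `<=` A &
    forall x, A x -> x \notin S0 -> norm (f x - v) < e.

Lemma eventually_ex P : eventually P -> exists S, [set` S] `<=` A /\ P S.
Proof. by case=> S0 S0A h; exists S0; split => //; apply: h. Qed.

Lemma eventuallyS P Q : (forall S, [set` S] `<=` A -> P S -> Q S) ->
  eventually P -> eventually Q.
Proof. by move=> PQ [S0 S0A h]; exists S0 => // S S0S SA; apply/PQ/h. Qed.

Lemma eventuallyI P Q : eventually P -> eventually Q ->
  eventually (fun S => P S /\ Q S).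
Proof.
move=> [S0 S0A hP] [S1 S1A hQ]; exists (S0 `|` S1)%fset.
  by move=> x /=; rewrite inE => /orP[/S0A|/S1A].
by move=> S; rewrite fsubUset => /andP[S0S S1S] SA; split; [apply: hP|apply: hQ].
Qed.

Lemma eventually_sup (S0 : {fset T}) : [set` S0] `<=` A ->
  eventually (fun S => (S0 `<=` S)%fset).
Proof. by move=> S0A; exists S0. Qed.

Lemma has_lim_ext Phi Psi v :
  (forall S, [set` S] `<=` A -> Phi S = Psi S) -> has_lim Phi v -> has_lim Psi v.
Proof.
by move=> PP hP e /hP; apply: eventuallyS => S /PP ->.
Qed.

Lemma has_lim_unique Phi v w : has_lim Phi v -> has_lim Phi w -> v = w.
Proof.
move=> hv hw; apply/eqP; rewrite -subr_eq0 -(norm_eq0 hK).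
apply/negP => /negP; rewrite -(normC hK) => vw.
have e0 : 0 < norm (w - v) by rewrite lt_def vw (norm_ge0 hK).
have [S [_ [Sv Sw]]] := eventually_ex (eventuallyI (hv _ e0) (hw _ e0)).
rewrite (normC hK) in Sw.
by have := dist_lt hK Sw Sv; rewrite ltxx.
Qed.

Lemma has_lim_cst v : has_lim (fun=> v) v.
Proof. by move=> e e0; exists fset0 => // S; rewrite subrr (norm0 hK). Qed.

Lemma has_limD Phi Psi v w : has_lim Phi v -> has_lim Psi w ->
  has_lim (fun S => Phi S + Psi S) (v + w).
Proof.
move=> hv hw e e0; apply: eventuallyS (eventuallyI (hv _ e0) (hw _ e0)).
by move=> S _ [Sv Sw]; rewrite opprD addrACA; apply: (norm_lt hK).
Qed.

Lemma has_lim_bounded Phi v : has_lim Phi v ->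
  eventually (fun S => norm (Phi S) < norm v + 1).
Proof.
move=> /(_ 1 ltr01); apply: eventuallyS => S _ Sv.
rewrite -(subrK v (Phi S)); apply: (norm_lt hK); last by rewrite ltrDl.
by apply: lt_le_trans Sv _; rewrite lerDr (norm_ge0 hK).
Qed.

Lemma has_limM Phi Psi v w : has_lim Phi v -> has_lim Psi w ->
  has_lim (fun S => Phi S * Psi S) (v * w).
Proof.
move=> hv hw e e0.
have v1 : 0 < norm v + 1 by rewrite ltr_wpDl ?(norm_ge0 hK).
have w1 : 0 < norm w + 1 by rewrite ltr_wpDl ?(norm_ge0 hK).
have := eventuallyI (has_lim_bounded hw)
  (eventuallyI (hv _ (divr_gt0 e0 w1)) (hw _ (divr_gt0 e0 v1))).
apply: eventuallyS => S _ [Sb [Sv Sw]].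
have -> : Phi S * Psi S - v * w = (Phi S - v) * Psi S + v * (Psi S - w) by ring.
apply: (norm_lt hK); rewrite (normM hK).
  apply: (@le_lt_trans _ _ (norm (Phi S - v) * (norm w + 1))).
    by rewrite ler_wpM2l ?(norm_ge0 hK) // ltW.
  by rewrite -ltr_pdivlMr.
apply: (@le_lt_trans _ _ ((norm v + 1) * norm (Psi S - w))).
  by rewrite ler_wpM2r ?(norm_ge0 hK) // lerDl.
by rewrite mulrC -ltr_pdivlMr.
Qed.

Lemma has_limN Phi v : has_lim Phi v -> has_lim (fun S => - Phi S) (- v).
Proof.
move=> hv e /hv; apply: eventuallyS => S _.
by rewrite -opprD (normN hK).
Qed.

Lemma has_limB Phi Psi v w : has_lim Phi v -> has_lim Psi w ->
  has_lim (fun S => Phi S - Psi S) (v - w).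
Proof. by move=> hv /has_limN; apply: has_limD. Qed.

Lemma has_lim_norm Phi v : v != 0 -> has_lim Phi v ->
  eventually (fun S => norm (Phi S) = norm v).
Proof.
rewrite -(norm_gt0 hK) => v0 /(_ _ v0).
by apply: eventuallyS => S _ /(norm_near hK).
Qed.

Lemma has_limV Phi v : v != 0 -> has_lim Phi v ->
  has_lim (fun S => (Phi S)^-1) v^-1.
Proof.
move=> v0 hv e e0; have nv : 0 < norm v by rewrite (norm_gt0 hK).
have := eventuallyI (has_lim_norm v0 hv)
  (hv _ (mulr_gt0 e0 (mulr_gt0 nv nv))).
apply: eventuallyS => S _ [Sn Sv].
have P0 : Phi S != 0 by rewrite -(norm_gt0 hK) Sn.
have -> : (Phi S)^-1 - v^-1 = (v - Phi S) / (Phi S * v) by field; rewrite P0 v0.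
rewrite (normM hK) (normV hK) (normM hK) Sn ltr_pdivrMr ?mulr_gt0 //.
by rewrite (normC hK).
Qed.

(** If the limit is nonzero, the norms eventually equal its norm, so the bound can be read off at a
    single [S]. *)
Lemma has_lim_le Phi v t : has_lim Phi v ->
  eventually (fun S => norm (Phi S) <= t) -> norm v <= t.
Proof.
move=> hv ht; have [->|v0] := eqVneq v 0.
  have [S [_ St]] := eventually_ex ht.
  by rewrite (norm0 hK) (le_trans _ St) ?(norm_ge0 hK).
have [S [_ [Sv St]]] := eventually_ex (eventuallyI (has_lim_norm v0 hv) ht).
by rewrite -Sv.
Qed.

(** Completeness is given for sequences only: approximate limits within [1/(n+1)] are chosen, and
    two of them are compared through a common finite set [S]. *)
Lemma has_lim_cauchy Phi :
  (forall e, 0 < e -> exists v, eventually (fun S => norm (Phi S - v) < e)) ->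
  exists v, has_lim Phi v.
Proof.
move=> hC.
have e_gt0 n : 0 < (n.+1%:R)^-1 :> R by rewrite invr_gt0.
pose u n := xget 0 [set v | eventually (fun S => norm (Phi S - v) < n.+1%:R^-1)].
have uP n : eventually (fun S => norm (Phi S - u n) < n.+1%:R^-1).
  by rewrite /u; case: xgetP => [v ->//|h]; have [v /h] := hC _ (e_gt0 n).
have small (e : R) : 0 < e -> exists N, forall k, (N <= k)%N -> k.+1%:R^-1 < e.
  move=> e0; have [N _ hN] := near_infty_natSinv_lt (PosNum e0).
  by exists N => k /hN.
have [|v hv] := Cp_complete hK (u := u).
  move=> e /small[N hN]; exists N => k l /hN ke /hN le.
  have [S [_ [Sk Sl]]] := eventually_ex (eventuallyI (uP k) (uP l)).
  apply: (dist_lt hK (y := Phi S)); last exact: lt_trans Sl le.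
  by rewrite (normC hK); exact: lt_trans Sk ke.
exists v => e e0; have [N hN] := small _ e0; have [M hM] := hv _ e0.
have [k Nk Mk] : exists2 k, (N <= k)%N & (M <= k)%N.
  by exists (maxn N M); rewrite leq_max leqnn ?orbT.
apply: eventuallyS (uP k) => S _ Sk.
by apply: (dist_lt hK (y := u k)); [apply: lt_trans Sk (hN _ Nk)|exact: hM].
Qed.

(** * Infinite products of factors tending to 1 *)

Lemma norm_prod_eq1 (s : seq T) (f : T -> K) :
  {in s, forall x, norm (f x) = 1} -> norm (\prod_(x <- s) f x) = 1.
Proof.
move=> f1; rewrite big_seq; elim/big_ind: _ => [|x y|x /f1 //].
  exact: norm1 hK.
by rewrite (normM hK) => -> ->; rewrite mulr1.
Qed.

Lemma norm_prod_sub1 (s : seq T) (f : T -> K) e : 0 < e -> e <= 1 ->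
  {in s, forall x, norm (f x - 1) < e} -> norm (\prod_(x <- s) f x - 1) < e.
Proof.
move=> e0 e1; elim: s => [|x s IH] fe.
  by rewrite big_nil subrr (norm0 hK).
rewrite big_cons.
have -> : f x * \prod_(j <- s) f j - 1 =
  f x * (\prod_(j <- s) f j - 1) + (f x - 1) by ring.
have fx := fe x (mem_head x s).
apply: (norm_lt hK) => //; rewrite (normM hK).
have -> : norm (f x) = 1.
  by rewrite -(norm1 hK); apply: (norm_near hK); rewrite (norm1 hK); exact: lt_le_trans fx e1.
by rewrite mul1r; apply: IH => y ys; apply: fe; rewrite inE ys orbT.
Qed.

Lemma big_fsetD (V : Type) (idx : V) (op : Monoid.com_law idx)
    (S0 S : {fset T}) (f : T -> V) : (S0 `<=` S)%fset ->
  \big[op/idx]_(x <- S) f x =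
  op (\big[op/idx]_(x <- S0) f x) (\big[op/idx]_(x <- (S `\` S0)%fset) f x).
Proof.
move=> S0S; rewrite (big_fsetID _ [in S0]) /=; congr (op _ _).
  by apply: eq_fbigl => x; rewrite !inE /= andb_idl // => /(fsubsetP S0S).
by apply: eq_fbigl => x; rewrite !inE /= andbC.
Qed.

(** Outside a finite set [S1] the factors have norm 1, so partial products containing [S1] all have
    the same norm. This turns closeness of the remaining factors to 1 into a Cauchy condition and
    keeps the limit away from 0. *)
Lemma has_prod_ex (f : T -> K) : (forall x, A x -> f x != 0) -> tends f 1 ->
  exists2 v, v != 0 & has_prod norm A f v.
Proof.
move=> f0 f1; pose P (S : {fset T}) := \prod_(x <- S) f x.
have P0 S : [set` S] `<=` A -> P S != 0.
  by move=> SA; rewrite /P prodf_seq_neq0; apply/allP => x xS; exact/f0/SA.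
have [S1 S1A hS1] := f1 1 ltr01.
have N1 : 0 < norm (P S1) by rewrite (norm_gt0 hK) P0.
have f_unit x : A x -> x \notin S1 -> norm (f x) = 1.
  move=> Ax xS1; rewrite -(norm1 hK); apply: (norm_near hK).
  by rewrite (norm1 hK); exact: hS1.
have normP S : (S1 `<=` S)%fset -> [set` S] `<=` A -> norm (P S) = norm (P S1).
  move=> S1S SA; rewrite /P (big_fsetD _ _ S1S) /= (normM hK).
  rewrite [X in _ * X]norm_prod_eq1 ?mulr1 // => x; rewrite !inE => /andP[xS1 xS].
  by apply: f_unit => //; exact: SA.
have [|v hv] := @has_lim_cauchy P.
  move=> e e0; pose e' := Num.min 1 (e / norm (P S1)).
  have e'0 : 0 < e' by rewrite lt_min ltr01 divr_gt0.
  have [S2 S2A hS2] := f1 _ e'0; exists (P (S1 `|` S2)%fset).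
  exists (S1 `|` S2)%fset.
    by move=> x /=; rewrite inE => /orP[/S1A|/S2A].
  move=> S S12 SA; have S12A : [set` (S1 `|` S2)%fset] `<=` A.
    by move=> x /= xS; apply: SA; exact: (fsubsetP S12).
  rewrite /P (big_fsetD _ _ S12) /= -[X in _ - X]mulr1 -mulrBr (normM hK).
  rewrite -/(P _) normP ?fsubsetUl // mulrC -ltr_pdivlMr //.
  apply: lt_le_trans (norm_prod_sub1 e'0 _ _) _.
  - by rewrite ge_min lexx.
  - move=> x; rewrite !inE negb_or => /andP[/andP[_ xS2] xS].
    by apply: hS2 => //; exact: SA.
  - by rewrite ge_min lexx orbT.
exists v => //; apply/eqP => v0; subst v.
have [S [SA [+ S1S]]] := eventually_ex (eventuallyI (hv _ N1) (eventually_sup S1A)).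
by rewrite subr0 normP // ltxx.
Qed.

End FiniteSubsets.

(** * Infinite products and their logarithmic derivatives *)

Section Products.
Variables (R : realType) (p : nat) (K : fieldType) (norm : K -> R).
Hypotheses (hp : prime p) (hK : is_Cp p norm).
Variables (T : choiceType) (A : set T).

Lemma has_sum_ex (f : T -> K) : tends norm A f 0 ->
  exists v, has_lim norm A (fun S => \sum_(x <- S) f x) v.
Proof.
move=> f0; apply: (has_lim_cauchy hK) => e e0; have [S0 S0A hS0] := f0 _ e0.
exists (\sum_(x <- S0) f x), S0 => // S S0S SA.
rewrite (big_fsetD _ _ S0S) /= addrAC subrr add0r big_seq.
elim/big_ind: _ => [|x y|x]; first by rewrite (norm0 hK).
  exact: (norm_lt hK).
by rewrite !inE => /andP[xS0 /SA xA]; rewrite -[f x]subr0 hS0.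
Qed.

Lemma tends_bounded (f : T -> K) v : tends norm A f v ->
  exists2 M : R, 0 < M & forall x, A x -> norm (f x) <= M.
Proof.
move=> fv; have [S0 S0A hS0] := fv 1 ltr01.
exists (1 + norm v + \sum_(x <- S0) norm (f x)).
  rewrite -addrA ltr_pwDl // addr_ge0 ?(norm_ge0 hK) // sumr_ge0 // => x _.
  exact: norm_ge0 hK _.
move=> x Ax; have [xS0|/(hS0 _ Ax)/ltW fx] := boolP (x \in S0).
  rewrite (big_fsetD1 x) //= addrCA lerDl !addr_ge0 ?(norm_ge0 hK) // sumr_ge0 // => y _.
  exact: norm_ge0 hK _.
have sum0 : 0 <= \sum_(x <- S0) norm (f x).
  by apply: sumr_ge0 => y _; exact: norm_ge0 hK _.
rewrite -[leLHS]addr0 lerD // -(subrK v (f x)).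
have v0 := norm_ge0 hK v.
by apply: (norm_le hK); [apply: le_trans fx _; rewrite lerDl|rewrite lerDr].
Qed.

Lemma has_prod_reindex (f : T -> K) (phi psi : T -> T) v :
  cancel phi psi -> cancel psi phi ->
  (forall x, A x -> A (phi x)) -> (forall x, A x -> A (psi x)) ->
  has_prod norm A f v -> has_prod norm A (f \o phi) v.
Proof.
move=> phiK psiK Aphi Apsi hv e e0; have [S0 S0A hS0] := hv e e0.
exists [fset psi x | x in S0]%fset.
  by move=> _ /= /imfsetP[x /= xS0 ->]; apply/Apsi/S0A.
move=> S S0S SA.
have -> : \prod_(x <- S) (f \o phi) x = \prod_(x <- [fset phi x | x in S]%fset) f x.
  by rewrite big_imfset //= => x y _ _; exact: can_inj phiK x y.
apply: hS0; last by move=> _ /= /imfsetP[x /= xS ->]; apply/Aphi/SA.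
apply/fsubsetP => x xS0; apply/imfsetP; exists (psi x); rewrite ?psiK //=.
by apply: (fsubsetP S0S); apply/imfsetP; exists x.
Qed.

(** Ultrametric errors do not accumulate, so the constants are independent of [s]. The first bound
    is carried along to control the cross term [h * f x * (P - 1)]. *)
Lemma norm_prod_expansion (s : seq T) (h : K) (f f0 : T -> K) (M N : R) :
  0 <= M -> 0 <= N -> norm h * M <= 1 ->
  {in s, forall x, norm (f x) <= M} ->
  {in s, forall x, norm (f x - f0 x) <= norm h * N} ->
  norm (\prod_(x <- s) (1 + h * f x) - 1) <= norm h * M /\
  norm (\prod_(x <- s) (1 + h * f x) - 1 - h * \sum_(x <- s) f0 x)
    <= norm h ^+ 2 * (M ^+ 2 + N).
Proof.
move=> M0 N0 hM; have h0 := norm_ge0 hK h.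
have MN0 : 0 <= M ^+ 2 + N by rewrite addr_ge0 ?exprn_ge0.
elim: s => [|x s IH] fM fN.
  by rewrite !big_nil mulr0 subr0 subrr (norm0 hK) !mulr_ge0 ?exprn_ge0.
have [||IH1 IH2] := IH; try by move=> y ys; (apply: fM || apply: fN); rewrite inE ys orbT.
rewrite !big_cons; set P := \prod_(_ <- _) _ in IH1 IH2 *.
set Q := \sum_(_ <- _) _ in IH2 *.
have fx : norm (f x) <= M by apply: fM; rewrite mem_head.
have fx0 : norm (f x - f0 x) <= norm h * N by apply: fN; rewrite mem_head.
have hfx : norm (h * f x) <= norm h * M by rewrite (normM hK) ler_wpM2l.
have hfP : norm (h * f x * (P - 1)) <= norm h * M * (norm h * M).
  by rewrite (normM hK); apply: ler_pM; rewrite ?(norm_ge0 hK).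
split.
  have -> : (1 + h * f x) * P - 1 = (P - 1) + (h * f x * (P - 1) + h * f x) by ring.
  do ![apply: (norm_le hK) => //]; apply: le_trans hfP _.
  by rewrite ler_piMl // mulr_ge0.
have -> : (1 + h * f x) * P - 1 - h * (f0 x + Q) =
  (P - 1 - h * Q) + (h * f x * (P - 1) + h * (f x - f0 x)) by ring.
do ![apply: (norm_le hK) => //].
  apply: le_trans hfP _; rewrite mulrACA -!expr2 ler_wpM2l ?exprn_ge0 //.
  by rewrite lerDl.
rewrite (normM hK) expr2 -mulrA; apply: ler_wpM2l => //.
apply: le_trans fx0 _; apply: ler_wpM2l => //.
by rewrite lerDr exprn_ge0.
Qed.

(** * Logarithmic derivatives *)

Lemma is_derivative_unique (f : K -> K) z l l' :
  is_derivative norm f z l -> is_derivative norm f z l' -> l = l'.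
Proof.
move=> hl hl'; apply/eqP; rewrite -subr_eq0; apply/negPn/negP => ll'.
have e0 : 0 < norm (l - l') by rewrite (norm_gt0 hK).
have [r r0 hr] := hl _ e0; have [r' r'0 hr'] := hl' _ e0.
have [h h0] : exists2 h : K, h != 0 & norm h < Num.min r r'.
  by apply: (norm_small hp hK); rewrite lt_min r0.
rewrite lt_min => /andP[/(hr _ h0) h1 /(hr' _ h0) h2].
rewrite (normC hK) in h1.
by have := dist_lt hK h1 h2; rewrite ltxx.
Qed.

Lemma derivativeE (f : K -> K) z l : is_derivative norm f z l ->
  derivative norm f z = l.
Proof.
move=> hl; rewrite /derivative; case: xgetP => [l' ->|/(_ l)//].
by move=> hl'; exact: is_derivative_unique hl' hl.
Qed.

Section LogDerivative.
Variables (x y : T -> K) (z : K) (eps : R) (U : K -> K).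
Hypotheses (eps0 : 0 < eps)
  (hx : forall t, A t -> eps <= norm (z - x t))
  (hy : forall t, A t -> eps <= norm (z - y t))
  (hxy : tends norm A (fun t => x t - y t) 0)
  (hU : forall z', norm (z' - z) < eps ->
     has_prod norm A (fun t => (z' - x t) / (z' - y t)) (U z')).

(** Moving [z] by less than [eps] changes none of its distances to the zeros and poles, which makes
    the estimates uniform in [t]. *)
Let far_shift (f : T -> K) h t : norm h < eps -> eps <= norm (z - f t) ->
  norm (z + h - f t) = norm (z - f t).
Proof. by move=> he /(lt_le_trans he) /(normDl hK) <-; rewrite addrAC. Qed.

Let far_neq0 (f : T -> K) t : eps <= norm (z - f t) -> z - f t != 0.
Proof. by move=> /(lt_le_trans eps0); rewrite (norm_gt0 hK). Qed.

Lemma quotient_tends1 : tends norm A (fun t => (z - x t) / (z - y t)) 1.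
Proof.
move=> e e0; have [S0 S0A hS0] := hxy (mulr_gt0 e0 eps0).
exists S0 => // t At tS0.
have -> : (z - x t) / (z - y t) - 1 = - (x t - y t) / (z - y t).
  by field; exact: far_neq0 (hy At).
rewrite (normM hK) (normV hK) (normN hK) ltr_pdivrMr.
  have := hS0 _ At tS0; rewrite subr0 => /lt_le_trans; apply.
  by rewrite ler_wpM2l ?(ltW e0) ?hy.
by rewrite (lt_le_trans eps0) ?hy.
Qed.

Lemma log_derivative_tends0 :
  tends norm A (fun t => (x t - y t) / ((z - x t) * (z - y t))) 0.
Proof.
move=> e e0; have [S0 S0A hS0] := hxy (mulr_gt0 e0 (mulr_gt0 eps0 eps0)).
exists S0 => // t At tS0; rewrite subr0 (normM hK) (normV hK) (normM hK).
have := hS0 _ At tS0; rewrite subr0 => xye.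
rewrite ltr_pdivrMr ?mulr_gt0 ?(lt_le_trans eps0 (hx At)) ?(lt_le_trans eps0 (hy At)) //.
apply: lt_le_trans xye _; rewrite ler_wpM2l ?(ltW e0) // ler_pM ?(ltW eps0) //.
  exact: hx.
exact: hy.
Qed.

Lemma log_derivative_neq0 : U z != 0.
Proof.
have [t At|v v0 hv] := has_prod_ex hK _ quotient_tends1.
  by apply: mulf_neq0; rewrite ?invr_eq0; apply: far_neq0; [exact: hx|exact: hy].
have Uz : has_prod norm A (fun t => (z - x t) / (z - y t)) (U z).
  by apply: hU; rewrite subrr (norm0 hK).
by rewrite (has_lim_unique hK Uz hv).
Qed.

(* Each factor at [z + h] is the factor at [z] times [1 + h s] with
   [s = (x - y) / ((z - x) (z + h - y))]; the products of the [1 + h s] are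
   expanded to first order in [h], uniformly in the finite set of factors. *)
Lemma log_derivative : exists2 L,
  has_lim norm A (fun S => \sum_(t <- S) (x t - y t) / ((z - x t) * (z - y t))) L
  & is_derivative norm U z (U z * L).
Proof.
have [L hL] := has_sum_ex log_derivative_tends0; exists L => //.
have [M0 M00 hM0] := tends_bounded hxy.
(* [M] bounds the coefficients [s], and [norm h * N] bounds their change when [h] is replaced by 0
   in the denominator. *)
pose M := M0 / eps ^+ 2; pose N := M / eps.
have M_gt0 : 0 < M by rewrite divr_gt0 ?exprn_gt0.
have N_gt0 : 0 < N by rewrite divr_gt0.
have Uz0 := log_derivative_neq0.
have nUz : 0 < norm (U z) by rewrite (norm_gt0 hK).
have MN : 0 < M ^+ 2 + N by rewrite addr_gt0 ?exprn_gt0.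
(* The three bounds preserve the norms of the denominators, give [norm h * M <= 1] for the
   expansion, and make the final error at most [e / 2]; halving [e] leaves room for the non-strict
   bound that survives a limit. *)
move=> e e0; exists (Num.min eps (Num.min M^-1 (e / 2 / (norm (U z) * (M ^+ 2 + N))))).
  by rewrite !lt_min eps0 invr_gt0 M_gt0 !divr_gt0 ?mulr_gt0.
move=> h h0; rewrite !lt_min => /and3P[heps hM he].
have nh : 0 < norm h by rewrite (norm_gt0 hK).
have Uz : has_prod norm A (fun t => (z - x t) / (z - y t)) (U z).
  by apply: hU; rewrite subrr (norm0 hK).
have Uzh : has_prod norm A (fun t => (z + h - x t) / (z + h - y t)) (U (z + h)).
  by apply: hU; rewrite addrAC subrr add0r.
have zhy t : A t -> z + h - y t != 0.
  by move=> At; rewrite -(norm_gt0 hK) far_shift ?hy // (lt_le_trans eps0) ?hy.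
(* The error of the difference quotient is itself a limit over finite sets, so it is enough to bound
   it for large [S], where the partial product has the norm of [U z]. *)
have := has_limB hK (has_limM hK (has_limB hK Uzh Uz) (has_lim_cst hK A h^-1))
  (has_limM hK Uz hL).
move=> /(has_lim_le hK) H; apply: (@le_lt_trans _ _ (e / 2)); last first.
  by rewrite ltr_pdivrMr // mulr_natr mulr2n ltrDl.
apply: H; apply: eventuallyS (has_lim_norm hK Uz0 Uz) => S SA PS.
pose s t := (x t - y t) / ((z - x t) * (z + h - y t)).
pose s0 t := (x t - y t) / ((z - x t) * (z - y t)).
have sM t : A t -> norm (s t) <= M.
  move=> At; rewrite (normM hK) (normV hK) (normM hK) far_shift ?hy // /M.
  rewrite ler_pM ?invr_ge0 ?mulr_ge0 ?(norm_ge0 hK) ?hM0 //.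
  rewrite lef_pV2 ?posrE ?exprn_gt0 ?mulr_gt0 ?(lt_le_trans eps0) ?hx ?hy //.
  by rewrite expr2 ler_pM ?(ltW eps0) ?hx ?hy.
have sN t : A t -> norm (s t - s0 t) <= norm h * N.
  move=> At.
  have -> : s t - s0 t = s t * (- h / (z - y t)).
    rewrite /s /s0; field.
    by rewrite !far_neq0 ?hx ?hy // zhy.
  rewrite (normM hK) mulrC (normM hK) (normN hK) -mulrA ler_wpM2l ?(ltW nh) //.
  rewrite mulrC /N ler_pM ?(norm_ge0 hK) ?sM // (normV hK).
  by rewrite lef_pV2 ?posrE ?(lt_le_trans eps0) ?hy.
have [|||_] := @norm_prod_expansion S h s s0 M N (ltW M_gt0) (ltW N_gt0).
- by rewrite -ler_pdivlMr // div1r ltW.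
- by move=> t /SA /sM.
- by move=> t /SA /sN.
set P := \prod_(_ <- _) _; set Q := \sum_(_ <- _) s0 _ => PQ.
have -> : \prod_(t <- S) ((z + h - x t) / (z + h - y t)) =
    \prod_(t <- S) ((z - x t) / (z - y t)) * P.
  rewrite -big_split /=; apply: eq_big_seq => t /SA At; rewrite /s; field.
  by rewrite !far_neq0 ?hx ?hy // zhy.
set PZ := \prod_(_ <- _) _ in PS *.
have -> : (PZ * P - PZ) / h - PZ * Q = PZ * (P - 1 - h * Q) / h by field.
rewrite !(normM hK) (normV hK) PS ler_pdivrMr // mulrC -ler_pdivlMr //.
apply: le_trans PQ _.
move: he; rewrite ltr_pdivlMr ?mulr_gt0 // => /ltW he; rewrite ler_pdivlMr //.
have -> : norm h ^+ 2 * (M ^+ 2 + N) * norm (U z) =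
  norm h * (norm (U z) * (M ^+ 2 + N)) * norm h by ring.
by rewrite ler_wpM2r // ltW.
Qed.

End LogDerivative.
End Products.

(** * Moebius transformations *)

Section Moebius.
Variable K : fieldType.
Implicit Types (A : 'M[K]_2) (x y : PGL2 K) (P : P1 K).

Lemma mulmx2E (A B : 'M[K]_2) i j : (A *m B) i j = A i 0 * B 0 j + A i 1 * B 1 j.
Proof.
rewrite mxE !big_ord_recl big_ord0 addr0.
by have -> : lift ord0 ord0 = 1 :> 'I_2 by apply: val_inj.
Qed.

Lemma det_mx2 (A : 'M[K]_2) : \det A = A 0 0 * A 1 1 - A 0 1 * A 1 0.
Proof.
rewrite (expand_det_row _ 0) !big_ord_recl big_ord0 addr0 /cofactor !det_mx11.
rewrite !mxE /= /bump /= !addn0 expr0 mul1r expr1 mulN1r mulrN.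
by congr (_ * A _ _ - A _ _ * A _ _); apply: val_inj.
Qed.

Lemma unitmx2 (A : 'M[K]_2) : (A \in unitmx) = (A 0 0 * A 1 1 - A 0 1 * A 1 0 != 0).
Proof. by rewrite unitmxE unitfE det_mx2. Qed.

(** The cases are those of a zero or nonzero inner denominator. If it vanishes, invertibility of [B]
    makes the inner numerator nonzero, so 0/0 never occurs. *)
Lemma mobiusM A B P : A \in unitmx -> B \in unitmx ->
  mobius (A *m B) P = mobius A (mobius B P).
Proof.
rewrite !unitmx2 /mobius !mulmx2E.
set a := A 0 0; set b := A 0 1; set c := A 1 0; set d := A 1 1.
set a' := B 0 0; set b' := B 0 1; set c' := B 1 0; set d' := B 1 1.
move=> A0 B0; case: P => [w|] /=; last first.
  case: (eqVneq c' 0) => [c'0|c'0].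
    have a'0 : a' != 0 by apply: contraNneq B0 => ->; rewrite c'0; apply/eqP; ring.
    rewrite c'0 !mulr0 !addr0 mulf_eq0 (negPf a'0) orbF.
    by case: ifP => // _; congr Some; rewrite -mulf_div divff // mulr1.
  have -> : c * (a' / c') + d = (c * a' + d * c') / c' by field.
  rewrite mulf_eq0 invr_eq0 (negPf c'0) orbF; case: ifP => // /negbT h.
  by congr Some; field; rewrite h c'0.
have -> : (c * a' + d * c') * w + (c * b' + d * d') = c * (a' * w + b') + d * (c' * w + d') by ring.
have -> : (a * a' + b * c') * w + (a * b' + b * d') = a * (a' * w + b') + b * (c' * w + d') by ring.
case: (eqVneq (c' * w + d') 0) => [c'0|c'0].
  have a'0 : a' * w + b' != 0.
    apply: contraNneq B0 => a'0; apply/eqP.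
    have [c'0'|c'0'] := eqVneq c' 0.
      have d'0 : d' = 0 by move: c'0; rewrite c'0' mul0r add0r.
      by rewrite c'0' d'0; ring.
    have -> : a' * d' - b' * c' = a' * (c' * w + d') - c' * (a' * w + b') by ring.
    by rewrite c'0 a'0; ring.
  rewrite c'0 !mulr0 !addr0 mulf_eq0 (negPf a'0) orbF.
  by case: ifP => // _; congr Some; rewrite -mulf_div divff // mulr1.
have -> : c * ((a' * w + b') / (c' * w + d')) + d =
  (c * (a' * w + b') + d * (c' * w + d')) / (c' * w + d') by field.
rewrite mulf_eq0 invr_eq0 (negPf c'0) orbF; case: ifP => // /negbT h.
by congr Some; field; rewrite h c'0.
Qed.

Lemma mobius1 P : mobius 1%:M P = P.
Proof.
by case: P => [w|]; rewrite /mobius !mxE /= ?eqxx // mul0r add0r oner_eq0 mul1r addr0 divr1.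
Qed.

Lemma pgl_actM x y P : pgl_act (x * y)%g P = pgl_act x (pgl_act y P).
Proof.
elim/quotW: x => A; elim/quotW: y => B.
have -> : ((\pi_(PGL2 K) A)%qT * (\pi_(PGL2 K) B)%qT)%g = (\pi_(PGL2 K) (GL2_mul A B))%qT.
  exact: PGL2_mul_pi.
by rewrite !pgl_act_pi mobiusM ?(valP A) ?(valP B).
Qed.

Lemma pgl_act1 P : pgl_act 1%g P = P.
Proof. by rewrite pgl_act_pi mobius1. Qed.

Lemma pgl_actK x : cancel (pgl_act x) (pgl_act x^-1%g).
Proof. by move=> P; rewrite -pgl_actM mulVg pgl_act1. Qed.

(** Infinity not being fixed, the lower left entry [c] is nonzero; [q = -d/c] is the pole, [e = a/c]
    the image of infinity, and [k] is minus the determinant over [c^2]. *)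
Lemma pgl_act_normal_form x : pgl_act x None <> None ->
  exists q e k, [/\ k != 0, pgl_act x None = Some e, pgl_act x (Some q) = None &
    forall w, w != q -> pgl_act x (Some w) = Some (e + k / (w - q))].
Proof.
rewrite /pgl_act; have := valP (repr x); rewrite /= unitmx2.
move: (val (repr x)) => A A0; rewrite /mobius; move: A0.
set a := A 0 0; set b := A 0 1; set c := A 1 0; set d := A 1 1.
move=> A0; case: (eqVneq c 0) => // c0 _.
exists (- d / c), (a / c), ((b * c - a * d) / c ^+ 2); split => //.
- by rewrite mulf_neq0 ?invr_eq0 ?expf_neq0 // subr_eq0 eq_sym -subr_eq0.
- by rewrite mulrC divfK // addNr eqxx.
move=> w wq.
have cw : c * w + d != 0.
  apply: contra wq; rewrite addr_eq0 => /eqP cwd; apply/eqP.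
  by apply: (mulfI c0); rewrite cwd mulrC divfK.
rewrite (negPf cw); congr Some; field.
by rewrite c0 opprK mulrC cw.
Qed.

Lemma eigenvalue2 A l : eigenvalue A l ->
  (A 0 0 - l) * (A 1 1 - l) - A 0 1 * A 1 0 = 0.
Proof.
case/eigenvalueP => v vA; apply: contraNeq => A0.
have Au : A - l%:M \in unitmx by rewrite unitmx2 !mxE /= !mulr1n !mulr0n !subr0.
by rewrite -(mulmxK Au v) mulmxBr vA mul_mx_scalar subrr mul0mx.
Qed.

(* The fixed points are [(l - d) / c] for the two eigenvalues [l]. *)
Lemma hyperbolic_fixed_points (R : realType) (norm : K -> R) x :
  hyperbolic norm x -> pgl_act x None <> None ->
  exists w1 w2, [/\ w1 != w2, pgl_act x (Some w1) = Some w1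
                  & pgl_act x (Some w2) = Some w2].
Proof.
rewrite /hyperbolic /pgl_act; have := valP (repr x).
rewrite /= unitmx2; move: (val (repr x)) => A A0 [l1 [l2 [Al1 Al2 l12]]].
case: (eqVneq (A 1 0) 0) => // c0 _.
have fix_ l : eigenvalue A l ->
    mobius A (Some ((l - A 1 1) / A 1 0)) = Some ((l - A 1 1) / A 1 0).
  move=> /eigenvalue2 Al.
  have l0 : l != 0.
    by apply: contraNneq A0 => l0; rewrite -Al l0 !subr0.
  rewrite /mobius mulrC divfK // subrK (negPf l0); congr Some.
  apply: (mulIf l0); rewrite divfK //.
  have -> : A 0 1 = (A 0 0 - l) * (A 1 1 - l) / A 1 0.
    by apply: (mulIf c0); rewrite divfK //; apply/eqP; rewrite eq_sym -subr_eq0 Al.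
  by field.
exists ((l1 - A 1 1) / A 1 0), ((l2 - A 1 1) / A 1 0).
split; [|exact: fix_|exact: fix_].
apply: contra l12 => /eqP /(mulIf (invr_neq0 c0)) /(addIr _) ->.
by rewrite eqxx.
Qed.

End Moebius.

(** * Words *)

Section Words.
Variables (K : fieldType) (g : nat) (gamma : 'I_g -> PGL2 K).
Implicit Types (l h : letter g) (w : seq (letter g)).

Lemma letter_invK : involutive (@letter_inv g).
Proof. by case=> i b; rewrite /letter_inv /= negbK. Qed.

Lemma letter_inv_neq l : letter_inv l != l.
Proof. by case: l => i b; rewrite /letter_inv xpair_eqE /= eqxx; case: b. Qed.

Lemma letter_valV l :
  letter_val gamma (letter_inv l) = (letter_val gamma l)^-1%g.
Proof. by case: l => i [] //=; rewrite /letter_val /= invgK. Qed.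

Lemma word_val_cons l w :
  word_val gamma (l :: w) = (letter_val gamma l * word_val gamma w)%g.
Proof. by rewrite /word_val big_cons. Qed.

Lemma word_val_cat w1 w2 :
  word_val gamma (w1 ++ w2) = (word_val gamma w1 * word_val gamma w2)%g.
Proof. by rewrite /word_val big_cat. Qed.

Lemma word_val1 l : word_val gamma [:: l] = letter_val gamma l.
Proof. by rewrite /word_val big_seq1. Qed.

Lemma word_valV w : exists w', word_val gamma w' = (word_val gamma w)^-1%g.
Proof.
elim: w => [|l w [w' IH]]; first by exists [::]; rewrite /word_val big_nil invg1.
exists (w' ++ [:: letter_inv l]).
by rewrite word_val_cat word_val1 word_val_cons invgM IH letter_valV.
Qed.

Lemma reduced_word w :
  exists2 w', reduced w' & word_val gamma w' = word_val gamma w.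
Proof.
elim: w => [|l w [w' rw' ww']]; first by exists [::].
rewrite word_val_cons -ww'; case: w' rw' {ww'} => [|h w'] rw'.
  by exists [:: l] => //; rewrite word_val_cons.
have [lh|lh] := eqVneq l (letter_inv h); last first.
  by exists [:: l, h & w']; rewrite ?word_val_cons // /reduced /= lh.
exists w'; first by move: rw' => /path_sorted.
by rewrite word_val_cons lh letter_valV mulKg.
Qed.

Lemma finite_words_le m : finite_set (words_le gamma m).
Proof.
apply: (@sub_finite_set _ _ [set word_val gamma (bseqval b) | b in [set: m.-bseq (letter g)]]).
  by move=> _ [w [_ wm <-]]; exists (Bseq wm).
exact/finite_image/finite_finset.
Qed.

Section Generation.
Variables (Gamma : set (PGL2 K)).
Hypothesis hgen : gen_by (range gamma) = Gamma.

Lemma gen_subgroup : is_subgroup Gamma.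
Proof.
rewrite -hgen; split; first by rewrite inE => H [[H1 _] _]; rewrite inE in H1.
move=> x y; rewrite !inE => hx hy H [HH Hg].
have := HH.2 x y; rewrite !inE; apply; [exact: hx|exact: hy].
Qed.

Lemma Gamma1 : Gamma 1%g.
Proof. by have [] := gen_subgroup; rewrite inE. Qed.

Lemma GammaV x : Gamma x -> Gamma x^-1%g.
Proof. by have := group_closedV gen_subgroup (x := x); rewrite !inE. Qed.

Lemma GammaM x y : Gamma x -> Gamma y -> Gamma (x * y)%g.
Proof. by have := group_closedM gen_subgroup (x := x) (y := y); rewrite !inE. Qed.

Lemma Gamma_letter l : Gamma (letter_val gamma l).
Proof.
have hg i : Gamma (gamma i) by rewrite -hgen => H [_]; apply; exists i.
by rewrite /letter_val; case: ifP => _ //; exact/GammaV.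
Qed.

Lemma Gamma_word w : Gamma (word_val gamma w).
Proof.
elim: w => [|l w IH]; first by rewrite /word_val big_nil; exact: Gamma1.
by rewrite word_val_cons; apply: GammaM => //; exact: Gamma_letter.
Qed.

(** The values of reduced words form a subgroup containing the generators, and [Gamma] is the
    smallest one. *)
Lemma GammaP x : Gamma x -> exists2 w, reduced w & word_val gamma w = x.
Proof.
rewrite -hgen => /(_ [set x | exists2 w, reduced w & word_val gamma w = x]); apply.
split; last by move=> _ [i _ <-]; exists [:: (i, false)]; rewrite ?word_val1.
split; first by rewrite inE; exists [::]; rewrite /word_val ?big_nil.
move=> x1 x2; rewrite !inE => -[w1 _ <-] [w2 _ <-].
have [w2' <-] := word_valV w2.
by rewrite -word_val_cat; exact: reduced_word.
Qed.

Lemma words_le_Gamma m : words_le gamma m `<=` Gamma.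
Proof. by move=> _ [w [_ _ <-]]; exact: Gamma_word. Qed.

End Generation.
End Words.

(** * Dynamics of the letters on the discs *)

#[local] Arguments pgl_act : simpl never.

Lemma seq_lower_bound (R : realType) (T : eqType) (s : seq T) (f : T -> R) :
  (forall x, 0 < f x) -> exists2 e, 0 < e & {in s, forall x, e <= f x}.
Proof.
move=> f0; elim: s => [|x s [e e0 he]]; first by exists 1.
exists (Num.min (f x) e); first by rewrite lt_min f0.
move=> y; rewrite inE ge_min => /orP[/eqP ->|/he ->]; first by rewrite lexx.
exact: orbT.
Qed.

Section PingPong.
Variables (R : realType) (p : nat) (K : fieldType) (norm : K -> R).
Hypotheses (hp : prime p) (hK : is_Cp p norm).
Variables (g : nat) (gamma : 'I_g -> PGL2 K) (B B' : 'I_g -> oball R K).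
Hypotheses (hF : good_fdomain norm gamma B B')
  (hoo : fdomain_int norm B B' None).
Variable (c : R).
Hypothesis (hc : is_min [set x | exists s t : 'I_g + 'I_g, s != t /\
            x = bdist p norm (bpt (sides B B' s)) (bpt (sides B B' t))] c).

Implicit Types (l h : letter g) (w : seq (letter g)) (P Q : P1 K) (u v : K).

(** The letter of [gamma_i] gets the ball [B_i] and its inverse gets [B_i'], so that the two mapping
    conditions of a good domain become one condition on letters. *)
Definition side l : 'I_g + 'I_g := if l.2 then inr l.1 else inl l.1.
Definition ctr l := bcenter (sides B B' (side l)).
Definition rad l := bradius (sides B B' (side l)).
(** Boolean membership in [D_l], and below in [D_l^+]; infinity is in neither because all the balls
    are discs, see [sidesE]. *)
Definition in_open l P := if P is Some u then norm (u - ctr l) < rad l else false.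
Definition in_closed l P := if P is Some u then norm (u - ctr l) <= rad l else false.
Definition ratio : R := p%:R `^ (- c).
Local Notation act l := (pgl_act (letter_val gamma l)).

Lemma side_inj : injective side.
Proof. by case=> i b [j b']; rewrite /side /=; case: b; case: b' => // -[->]. Qed.

Lemma side_surj s : exists l, side l = s.
Proof. by case: s => i; [exists (i, false)|exists (i, true)]. Qed.

(** The closed ball of a [CoDisc] contains infinity, which lies in the interior of [F]. *)
Lemma sidesE s : sides B B' s = Disc (bcenter (sides B B' s)) (bradius (sides B B' s)).
Proof.
case E: (sides B B' s) => [//|a r]; exfalso; apply: hoo.
by exists s => //; rewrite E /= => -[].
Qed.

Lemma opnE l P : opn norm (sides B B' (side l)) P <-> in_open l P.
Proof.
rewrite sidesE /= -/(ctr l) -/(rad l); case: P => [u|]; split=> //=.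
- by move=> [x xl [<-]].
- by move=> ul; exists u.
- by case.
Qed.

Lemma clsE l P : cls norm (sides B B' (side l)) P <-> in_closed l P.
Proof.
rewrite sidesE /= -/(ctr l) -/(rad l); case: P => [u|]; split=> //=.
- by move=> [x xl [<-]].
- by move=> ul; exists u.
- by case.
Qed.

Lemma rad_gt0 l : 0 < rad l.
Proof. by have [h _ _ _] := hF; exact: h. Qed.

Lemma in_openW l P : in_open l P -> in_closed l P.
Proof. by case: P => [u|] //; exact: ltW. Qed.

Lemma in_closed_inj l h P : in_closed l P -> in_closed h P -> l = h.
Proof.
move=> /clsE lP /clsE hP; have [_ triv _ _] := hF.
by apply/side_inj/triv => //; exists P.
Qed.

Lemma ctr_dist l h : l != h -> rad l < norm (ctr l - ctr h).
Proof.
apply: contraNlt => lh; apply/eqP/(@in_closed_inj _ _ (Some (ctr h))).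
  by rewrite /in_closed (normC hK).
by rewrite /in_closed subrr (norm0 hK) ltW ?rad_gt0.
Qed.

Lemma act_image l :
  act l @` [set P | ~~ in_open (letter_inv l) P] = [set P | in_closed l P].
Proof.
have -> : [set P | in_closed l P] = cls norm (sides B B' (side l)).
  by apply/seteqP; split=> P /clsE.
have -> : [set P | ~~ in_open (letter_inv l) P] =
    ~` opn norm (sides B B' (side (letter_inv l))).
  by apply/seteqP; split=> P /= h; [move=> /opnE; apply/negP|apply/negP => /opnE].
have [_ _ h h'] := hF; rewrite /letter_val.
by case: l => i [] /=; [exact: h'|exact: h].
Qed.

Lemma act_out l P : ~~ in_open (letter_inv l) P -> in_closed l (act l P).
Proof.
by move=> lP; have : [set P | in_closed l P] (act l P) by rewrite -act_image; exists P.
Qed.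

Lemma act_surj l Q : in_closed l Q ->
  exists2 P, ~~ in_open (letter_inv l) P & act l P = Q.
Proof.
by move=> lQ; have : [set P | in_closed l P] Q by []; rewrite -act_image.
Qed.

Lemma act_letterK l : cancel (act l) (act (letter_inv l)).
Proof. by move=> P; rewrite letter_valV pgl_actK. Qed.

(** If [act l P] were outside [D_l], applying [l^-1] would bring it into the closed disc of [l^-1],
    where [P] is not. *)
Lemma act_out_closed l P : ~~ in_closed (letter_inv l) P -> in_open l (act l P).
Proof.
apply: contraNT => lP; rewrite -(act_letterK l P).
by apply: act_out; rewrite letter_invK.
Qed.

(* The image of the complement of D_(l^-1) is both D_l^+ and the closed disc of
   radius |k| / rad (l^-1) around [e]; the value group being dense, a closed disc
   determines its radius. *)
Lemma act_form l : exists q e k,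
  [/\ norm k = rad l * rad (letter_inv l),
      norm (q - ctr (letter_inv l)) < rad (letter_inv l),
      act l (Some q) = None &
      forall u, u != q -> act l (Some u) = Some (e + k / (u - q))].
Proof.
have [|q [e [k [k0 hoo' hq hu]]]] := @pgl_act_normal_form _ (letter_val gamma l).
  by move=> hN; have := @act_out l None isT; rewrite hN.
have ql : norm (q - ctr (letter_inv l)) < rad (letter_inv l).
  have := @act_out l (Some q); rewrite hq /=; case: ltP => // _ /(_ isT) //.
have el : norm (e - ctr l) <= rad l by have := @act_out l None isT; rewrite hoo'.
exists q, e, k; split=> //.
have r'0 := rad_gt0 (letter_inv l); set r' := rad _ in ql r'0 *.
have nk : 0 < norm k by rewrite (norm_gt0 hK).
(* [e + u] is the image of [q + k / u], which is outside the disc of [l^-1] when [u] is that small;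
   so [e + u] lies in [D_l^+]. *)
have le1 u : u != 0 -> norm u <= norm k / r' -> norm u <= rad l.
  move=> u0 uk; have ku0 : k / u != 0 by rewrite mulf_neq0 ?invr_eq0.
  have qu : q + k / u != q by rewrite -subr_eq0 addrAC subrr add0r.
  have : in_closed l (act l (Some (q + k / u))).
    apply: act_out; rewrite /= -leNgt leNgt; apply/negP => qul.
    have : norm (k / u) < r'.
      have -> : k / u = q + k / u - q by ring.
      by apply: (dist_lt hK qul); rewrite (normC hK).
    rewrite (normM hK) (normV hK) ltNge => /negP; apply.
    by rewrite ler_pdivlMr ?(norm_gt0 hK) // mulrC -ler_pdivlMr.
  have quE : k / (q + k / u - q) = u.
    by rewrite addrAC subrr add0r invf_div mulrC divfK.
  rewrite hu //= quE => eul; rewrite -[u](addrK e) [u + e]addrC.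
  by apply: (dist_le hK eul); rewrite (normC hK).
(* Conversely a point [e + u] of [D_l^+] has a preimage outside the disc of [l^-1]; its distance to
   the pole is [norm k / norm u], and at least [r']. *)
have le2 u : u != 0 -> norm u <= rad l -> norm u <= norm k / r'.
  move=> u0 ul; have : in_closed l (Some (e + u)).
    rewrite /= -addrA addrCA. by apply: (norm_le hK).
  move=> /act_surj[[v|]]; last first.
    rewrite hoo' => _ [] /eqP; rewrite -subr_eq0 opprD addNKr oppr_eq0.
    by rewrite (negPf u0).
  rewrite /= -leNgt => vl; have [->|vq] := eqVneq v q; first by rewrite hq.
  rewrite hu // => -[] /addrI ukv.
  have qv0 : v - q != 0 by rewrite subr_eq0.
  rewrite -ukv (normM hK) (normV hK) ler_pM2l // lef_pV2 ?posrE ?(norm_gt0 hK) //.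
  rewrite leNgt; apply/negP => vq'; move: vl; rewrite leNgt => /negP; apply.
  exact: (dist_lt hK vq').
have -> : rad l = norm k / r'; last by rewrite divfK // gt_eqF.
apply/eqP; rewrite eq_le !leNgt; apply/andP; split; apply/negP => lt_r.
  have [|u u1 u2] := norm_dense hp hK _ lt_r; first exact: divr_gt0.
  have u0 : u != 0 by rewrite -(norm_gt0 hK) (lt_trans _ u1) // divr_gt0.
  by have := lt_le_trans u1 (le2 _ u0 u2); rewrite ltxx.
have [|u u1 u2] := norm_dense hp hK _ lt_r; first exact: rad_gt0.
have u0 : u != 0 by rewrite -(norm_gt0 hK) (lt_trans _ u1) // rad_gt0.
by have := lt_le_trans u1 (le1 _ u0 u2); rewrite ltxx.
Qed.

(** * Distances between the discs and the contraction ratio *)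

Lemma logp_powR (x : R) : 0 < x -> p%:R `^ logp p x = x.
Proof.
move=> x0; have p1 := p_gt1 R hp; have p0 := lt_trans ltr01 p1.
rewrite /powR gt_eqF // /logp divfK ?lnK ?posrE //.
by rewrite gt_eqF // ln_gt0.
Qed.

(** The closed discs being disjoint, the smallest disc containing both has as radius the distance
    [D] of the centres, so the path length is the logarithm of [D^2 / (rad l * rad h)]. *)
Lemma powR_bdist l h : l != h ->
  p%:R `^ bdist p norm (bpt (sides B B' (side l))) (bpt (sides B B' (side h))) =
  norm (ctr l - ctr h) / rad l * (norm (ctr l - ctr h) / rad h).
Proof.
move=> lh; have l_lt := ctr_dist lh; have h_lt : rad h < norm (ctr l - ctr h).
  by rewrite (normC hK); apply: ctr_dist; rewrite eq_sym.
rewrite /bdist /bjoin /= -!/(ctr _) -!/(rad _).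
have -> : Num.max (norm (ctr l - ctr h)) (Num.max (rad l) (rad h)) = norm (ctr l - ctr h).
  by apply/max_idPl; rewrite ge_max !ltW.
have d0 := lt_trans (rad_gt0 l) l_lt.
have p0 : (p%:R : R) != 0 by rewrite gt_eqF // (lt_trans ltr01 (p_gt1 R hp)).
by rewrite powRD ?p0 ?implybT // !logp_powR ?divr_gt0 ?rad_gt0.
Qed.

Lemma ratio_gt0 : 0 < ratio.
Proof. by rewrite powR_gt0 // (lt_trans ltr01 (p_gt1 R hp)). Qed.

(** The minimum [c] is attained at two distinct discs, whose radii are both smaller than the
    distance of the centres; hence [c > 0]. *)
Lemma ratio_lt1 : ratio < 1.
Proof.
have [[s [t [st cE]]] _] := hc.
have [[l ls] [h ht]] := (side_surj s, side_surj t); subst s t.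
have lh : l != h by apply: contra st => /eqP ->.
have h_lt : rad h < norm (ctr l - ctr h).
  by rewrite (normC hK); apply: ctr_dist; rewrite eq_sym.
rewrite /ratio powRN invf_lt1 ?powR_gt0 ?(lt_trans ltr01 (p_gt1 R hp)) //.
rewrite cE powR_bdist // -[ltLHS]mulr1.
by apply: ltr_pM => //; rewrite ltr_pdivlMr ?rad_gt0 // mul1r // ctr_dist.
Qed.

Lemma ratio_le l h : l != h ->
  rad l * rad h / norm (ctr l - ctr h) ^+ 2 <= ratio.
Proof.
move=> lh; have d0 := lt_trans (rad_gt0 l) (ctr_dist lh).
have p1 := p_gt1 R hp; have p0 := lt_trans ltr01 p1.
rewrite /ratio powRN -[leLHS]invrK lef_pV2 ?posrE ?powR_gt0 //; last first.
  by rewrite invr_gt0 divr_gt0 ?mulr_gt0 ?exprn_gt0 ?rad_gt0.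
have -> : (rad l * rad h / norm (ctr l - ctr h) ^+ 2)^-1 =
    norm (ctr l - ctr h) / rad l * (norm (ctr l - ctr h) / rad h).
  by field; rewrite !gt_eqF ?rad_gt0.
rewrite -powR_bdist //; apply: ler_powR; first exact: ltW.
have [_ cmin] := hc; apply: cmin; exists (side l), (side h); split=> //.
by apply: contra lh => /eqP/side_inj ->.
Qed.

(* [w |-> e + k / (w - q)] scales distances on a disc avoiding the pole [q] by
   the constant [|k| / |w - q|^2]. *)
Lemma act_contract l h u v : h != letter_inv l ->
  norm (u - ctr h) <= rad h -> norm (v - ctr h) <= rad h ->
  exists u' v', [/\ act l (Some u) = Some u', act l (Some v) = Some v' &
    norm (u' - v') <= rad l / rad h * ratio * norm (u - v)].
Proof.
move=> hl uh vh; have [q [e [k [nk nq _ hact]]]] := act_form l.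
have D_gt : rad h < norm (ctr h - ctr (letter_inv l)) by exact: ctr_dist.
have D_gt' : rad (letter_inv l) < norm (ctr h - ctr (letter_inv l)).
  by rewrite (normC hK); apply: ctr_dist; rewrite eq_sym.
(* The pole lies in the disc of [l^-1], so every point of [D_h^+] is as far from it as the two
   centres are from each other. *)
have far x : norm (x - ctr h) <= rad h ->
    norm (x - q) = norm (ctr h - ctr (letter_inv l)).
  move=> xh; apply: (norm_near hK).
  have -> : x - q - (ctr h - ctr (letter_inv l)) =
    (x - ctr h) + (ctr (letter_inv l) - q) by ring.
  apply: (norm_lt hK); first exact: le_lt_trans xh D_gt.
  by rewrite (normC hK); exact: lt_trans nq D_gt'.
have D0 := lt_trans (rad_gt0 h) D_gt.
have neq x : norm (x - ctr h) <= rad h -> x != q.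
  by move=> /far xh; rewrite -subr_eq0 -(norm_gt0 hK) xh.
exists (e + k / (u - q)), (e + k / (v - q)); split; try by rewrite hact // neq.
have -> : e + k / (u - q) - (e + k / (v - q)) = - (k * (u - v)) / ((u - q) * (v - q)).
  by field; rewrite !subr_eq0 !neq.
rewrite (normM hK) (normN hK) (normV hK) !(normM hK) !far // nk.
set D := norm (ctr h - _) in D0 *.
have -> : rad l * rad (letter_inv l) * norm (u - v) / (D * D) =
  rad l / rad h * (rad h * rad (letter_inv l) / D ^+ 2) * norm (u - v).
  by field; rewrite !gt_eqF ?rad_gt0.
rewrite ler_wpM2r ?(norm_ge0 hK) // ler_wpM2l ?ratio_le //.
by rewrite divr_ge0 // ltW ?rad_gt0.
Qed.

(** * Images of points under reduced words *)

Local Notation wact w := (pgl_act (word_val gamma w)).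

Lemma wact_cons l w P : wact (l :: w) P = act l (wact w P).
Proof. by rewrite word_val_cons pgl_actM. Qed.

Lemma wact1 l P : wact [:: l] P = act l P.
Proof. by rewrite word_val1. Qed.

(** Only the last letter meets [P] and [Q] directly, so only the disc of its inverse must be
    avoided. It merely puts both points in its closed disc; each of the other [size w] letters
    contributes a factor [ratio], and the quotients of radii telescope to [rad l]. *)
Lemma word_contract l w P Q : reduced (l :: w) ->
  ~~ in_open (letter_inv (last l w)) P -> ~~ in_open (letter_inv (last l w)) Q ->
  exists u v, [/\ wact (l :: w) P = Some u, wact (l :: w) Q = Some v,
    norm (u - ctr l) <= rad l, norm (v - ctr l) <= rad l &
    norm (u - v) <= rad l * ratio ^+ size w].
Proof.
elim: w l => [|h w IH] l /= rw Pw Qw.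
  have := act_out Pw; have := act_out Qw; rewrite !wact1.
  case: (act l P) => [u|] //; case: (act l Q) => [v|] //= vl ul.
  exists u, v; split=> //; rewrite mulr1; apply: (dist_le hK ul).
  by rewrite (normC hK).
case/andP: rw => lh rw; have hl : h != letter_inv l.
  by apply: contra lh => /eqP ->; rewrite letter_invK.
have [u [v [hu hv uh vh uv]]] := IH h rw Pw Qw.
have [u' [v' [hu' hv' uv']]] := act_contract hl uh vh.
have out x : norm (x - ctr h) <= rad h -> ~~ in_open (letter_inv l) (Some x).
  move=> xh; apply: contra hl => /in_openW xl.
  by apply/eqP/(@in_closed_inj _ _ (Some x)).
exists u', v'; rewrite !(wact_cons l) hu hv; split=> //.
- by have := act_out (out _ uh); rewrite hu'.
- by have := act_out (out _ vh); rewrite hv'.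
apply: le_trans uv' _; rewrite exprS.
have -> : rad l * (ratio * ratio ^+ size w) =
  rad l / rad h * ratio * (rad h * ratio ^+ size w).
  by field; rewrite gt_eqF ?rad_gt0.
by rewrite ler_wpM2l // mulr_ge0 ?(ltW ratio_gt0) // divr_ge0 // ltW ?rad_gt0.
Qed.

Lemma word_out l w P : reduced (l :: w) ->
  ~~ in_open (letter_inv (last l w)) P -> in_closed l (wact (l :: w) P).
Proof.
by move=> rw Pw; have [u [v [-> _ ul _ _]]] := word_contract rw Pw Pw.
Qed.

(** The letters from [h] on put the point in [D_h^+], which is disjoint from the closed disc of
    [l^-1]; so [l] sends it into the open disc. *)
Lemma word_out_open l h w P : reduced (l :: h :: w) ->
  ~~ in_open (letter_inv (last h w)) P -> in_open l (wact (l :: h :: w) P).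
Proof.
move=> /andP[lh rw] Pw; rewrite wact_cons; apply: act_out_closed.
apply: contra lh => /in_closed_inj/(_ (word_out rw Pw)) <-.
by rewrite letter_invK.
Qed.

Definition in_F P := forall l, ~~ in_open l P.

Lemma fdomainE P : fdomain norm B B' P <-> in_F P.
Proof.
split=> [PF l|PF [s _]]; first by apply/negP => /opnE lP; apply: PF; exists (side l).
by have [l <-] := side_surj s => /opnE; apply/negP/PF.
Qed.

Lemma ratio_small (e : R) : 0 < e -> exists N, forall n, (N <= n)%N -> ratio ^+ n < e.
Proof.
move=> e0; have r1 : `|ratio| < 1 by rewrite ger0_norm ?ratio_lt1 // ltW ?ratio_gt0.
have /cvgrPdist_lt/(_ e e0)[N _ hN] := cvg_expr r1.
exists N => n /hN /=; rewrite distrC subr0 ger0_norm // exprn_ge0 // ltW ?ratio_gt0 //.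
Qed.

(** * Points of F, fixed points and Omega *)

Section Group.
Variable Gamma : set (PGL2 K).
Hypotheses (hGamma : schottky norm Gamma) (hgamma : free_generators Gamma gamma).
Variable d : R.
Hypothesis hd : is_min ([set bradius (sides B B' s) | s in setT]) d.

Let hgen : gen_by (range gamma) = Gamma := hgamma.1.

Lemma d_le l : d <= rad l.
Proof. by have [_ h] := hd; apply: h; exists (side l). Qed.

Lemma d_gt0 : 0 < d.
Proof. by have [[s _ <-] _] := hd; have [h _ _ _] := hF; exact: h. Qed.

Lemma in_F_near u v : in_F (Some u) -> norm (v - u) < d -> in_F (Some v).
Proof.
move=> uF vu l; apply: contra (uF l) => /= vl.
by apply: (dist_lt hK (y := v)) => //; rewrite (normC hK) (lt_le_trans vu) ?d_le.
Qed.

Lemma act_inv_open l P : in_open l P -> ~~ in_closed (letter_inv l) (act (letter_inv l) P).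
Proof.
move=> lP; apply/negP => /act_surj[Q]; rewrite letter_invK => lQ.
by move=> /(can_inj (act_letterK _)) QP; move: lQ; rewrite QP lP.
Qed.

(** The image lies in [D_l^+] but not in [D_l], as [l^-1] maps [D_l] off the closed disc of [l^-1].
    With [gamma_i] for [l] this puts [gamma_i a] in [F]. *)
Lemma in_F_act_boundary l P : in_F P -> in_closed (letter_inv l) P -> in_F (act l P).
Proof.
move=> PF Pl h; apply/negP => hP.
have lh : l = h.
  by apply: (in_closed_inj (P := act l P)); [exact: act_out|exact: in_openW].
by subst h; have := act_inv_open hP; rewrite act_letterK Pl.
Qed.

(** A reduced word of length at least 2 moves [F] into an open disc, hence off [F]. A point of [F]
    fixed by a single letter would lie in the closed discs of both the letter and its inverse. *)
Lemma in_F_fixed P x : in_F P -> Gamma x -> x <> 1%g -> pgl_act x P <> P.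
Proof.
move=> PF /(GammaP hgen)[[|l [|h w]] rw <-].
- by rewrite /word_val big_nil.
- move=> _; rewrite wact1 => lP.
  have lPl : in_closed l P by rewrite -lP; exact: act_out.
  have lP' : act (letter_inv l) P = P by rewrite -{1}lP act_letterK.
  have : in_closed (letter_inv l) P by rewrite -lP'; exact: act_out.
  by move=> /(in_closed_inj lPl) /esym/eqP; rewrite (negPf (letter_inv_neq _)).
- move=> _ wP; have := word_out_open rw (PF _); rewrite wP.
  by rewrite (negPf (PF _)).
Qed.

(** The disc of radius [d] around [u] is contained in [F], which has no fixed points; so [u] is not
    a limit of them either. *)
Lemma in_F_Omega u : in_F (Some u) -> Omega norm Gamma (Some u).
Proof.
move=> uF [[x [Gx x1]]|]; first exact: in_F_fixed.
move=> /(_ (Disc u d) d_gt0)[|y [[x [Gx x1 xy]] yu [v /= vu vy]]].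
  by exists u => //=; rewrite subrr (norm0 hK) d_gt0.
by subst y; apply: in_F_fixed xy => //; exact: in_F_near vu.
Qed.

Lemma letter_val_neq1 l : letter_val gamma l <> 1%g.
Proof.
move=> l1; have [_ /(_ [:: l] [::] isT isT)] := hgamma.
by rewrite word_val1 l1 /word_val big_nil => /(_ erefl).
Qed.

(** A hyperbolic letter has two fixed points. One outside the disc of [l^-1] lies in [D_l^+]; if
    both were in that disc, [l^-1] would fix them and yet strictly shrink their distance. *)
Lemma letter_fixed l : exists2 P, in_closed l P & act l P = P.
Proof.
have [_ _ hyp] := hGamma.
have [|u [v [uv fu fv]]] := hyperbolic_fixed_points (hyp _ (Gamma_letter hgen l) (@letter_val_neq1 l)).
  by move=> hN; have := @act_out l None isT; rewrite hN.
apply: contrapT => hno.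
have fix_in t : act l (Some t) = Some t -> norm (t - ctr (letter_inv l)) <= rad (letter_inv l).
  move=> ft; apply: ltW; apply: contrapT => /negP h.
  by apply: hno; exists (Some t) => //; rewrite -ft; exact: act_out.
have [|u' [v' [uu' vv']]] := act_contract (l := letter_inv l) _ (fix_in _ fu) (fix_in _ fv).
  by rewrite eq_sym; exact: letter_inv_neq.
move: uu' vv'; rewrite -{1}fu -{1}fv !act_letterK => -[<-] [<-].
rewrite divff ?gt_eqF ?rad_gt0 // mul1r leNgt => /negP; apply.
by rewrite -[ltRHS]mul1r ltr_pM2r ?ratio_lt1 // (norm_gt0 hK) subr_eq0.
Qed.

Lemma opn_near (D : oball R K) u : 0 < bradius D -> opn norm D (Some u) ->
  exists2 e : R, 0 < e & forall v, norm (v - u) < e -> opn norm D (Some v).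
Proof.
case: D => a r /= r0.
  move=> [x ua [xu]]; subst x; exists r => // v vu; exists v => //=.
  exact: (dist_lt hK vu).
move=> ua; have {}ua : r < norm (u - a).
  by rewrite ltNge; apply/negP => ua'; apply: ua; exists u.
exists (norm (u - a)); first exact: lt_trans r0 ua.
move=> v vu [x /= va [xv]]; subst x; move: va; rewrite leNgt => /negP; apply.
rewrite (@norm_near _ _ _ _ hK (u - a)) //.
by have -> : v - a - (u - a) = v - u by ring.
Qed.

Lemma ratio_small_rad (e : R) : 0 < e ->
  exists N, forall l n, (N <= n)%N -> rad l * ratio ^+ n < e.
Proof.
move=> e0; pose M := 1 + \sum_l rad l.
have sum0 : 0 <= \sum_l rad l by apply: sumr_ge0 => l _; rewrite ltW ?rad_gt0.
have M0 : 0 < M by rewrite ltr_pwDl.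
have radM l : rad l <= M.
  rewrite /M (bigD1 l) //= addrCA lerDl addr_ge0 // sumr_ge0 // => h _.
  by rewrite ltW ?rad_gt0.
have [N hN] := ratio_small (divr_gt0 e0 M0); exists N => l n /hN.
rewrite ltr_pdivlMr // mulrC; apply: le_lt_trans.
by rewrite ler_wpM2r // exprn_ge0 // ltW ?ratio_gt0.
Qed.

(** No translate of [P] being in [F], each lies in some open disc. Undoing the word found so far
    gives [Q] in some [D_h], and [h] is appended; the word stays reduced because [Q] avoids the
    closed disc of the inverse of the last letter. *)
Lemma nested_words P : (forall x, Gamma x -> ~ in_F (pgl_act x P)) -> forall n,
  exists l w Q, [/\ reduced (l :: w), size w = n, wact (l :: w) Q = P &
    ~~ in_closed (letter_inv (last l w)) Q].
Proof.
move=> PF.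
have cover x : Gamma x -> exists l, in_open l (pgl_act x P).
  move=> /PF hx; apply: contrapT => hno; apply: hx => l; apply/negP => lx.
  by apply: hno; exists l.
elim=> [|n [l [w [Q [rw <- wQ Qw]]]]].
  have [l] := cover _ (Gamma1 hgen); rewrite pgl_act1 => lP.
  exists l, [::], (act (letter_inv l) P); split=> //; last exact: act_inv_open.
  by rewrite wact1 -[X in act X]letter_invK act_letterK.
have QP : pgl_act (word_val gamma (l :: w))^-1%g P = Q by rewrite -wQ pgl_actK.
have [h hQ] := cover _ (GammaV hgen (Gamma_word hgen (l :: w))); rewrite QP in hQ.
exists l, (rcons w h), (act (letter_inv h) Q); split.
- rewrite /reduced /= rcons_path; apply/andP; split; first exact: rw.
  by apply: contra Qw => /eqP ->; rewrite letter_invK; exact: in_openW.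
- by rewrite size_rcons.
- rewrite -rcons_cons -cats1 word_val_cat pgl_actM wact1.
  by rewrite -[X in act X]letter_invK act_letterK.
- by rewrite last_rcons; exact: act_inv_open.
Qed.

(** Otherwise arbitrarily long reduced words carry some point to [P]. The same words carry a fixed
    point of their last letter to a fixed point of a conjugate, close to [P]; so [P] is a fixed
    point or a limit of fixed points. *)
Lemma Omega_cover P : Omega norm Gamma P ->
  exists2 x, Gamma x & exists2 Q, in_F Q & P = pgl_act x Q.
Proof.
move=> PO; apply: contrapT => hno.
have nested : forall n, exists l w Q, [/\ reduced (l :: w), size w = n,
    wact (l :: w) Q = P & ~~ in_closed (letter_inv (last l w)) Q].
  apply: nested_words => x Gx xF; apply: hno.
  exists x^-1%g; first exact: (GammaV hgen).
  by exists (pgl_act x P); rewrite ?pgl_actK.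
case: P PO {hno} nested => [u|] PO nested; last first.
  have [l [w [Q [rw _ wQ Qw]]]] := nested 0%N.
  have := word_out rw (contra (@in_openW _ _) Qw).
  by rewrite wQ.
apply: PO; have [ufix|ufix] := pselect (fixed_points Gamma (Some u)); first by left.
right=> D D0 Du; have [e e0 he] := opn_near D0 Du.
have [N hN] := ratio_small_rad e0.
have [l [w [Q [rw sw wQ Qw]]]] := nested N.
have [P lP fP] := letter_fixed (last l w).
have Pw : ~~ in_open (letter_inv (last l w)) P.
  apply/negP => /in_openW /(in_closed_inj lP)/esym/eqP.
  by rewrite (negPf (letter_inv_neq _)).
have [u' [v [uE vE _ _ uv]]] := word_contract rw (contra (@in_openW _ _) Qw) Pw.
move: uE; rewrite wQ => -[uE]; subst u'.
have vfix : fixed_points Gamma (Some v).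
  pose W := word_val gamma (l :: w); pose k := letter_val gamma (last l w).
  have GW : Gamma W by exact: Gamma_word hgen _.
  exists (W * k * W^-1)%g; split.
  - apply: (GammaM hgen); last exact: GammaV hgen _ GW.
    by apply: (GammaM hgen) => //; exact: Gamma_letter hgen _.
  - move=> WkW; apply: (@letter_val_neq1 (last l w)).
    by apply: (mulgI W); apply: (mulIg W^-1%g); rewrite -/k WkW mulg1 mulgV.
  - by rewrite -vE !pgl_actM pgl_actK fP.
exists (Some v); split=> //; first by move=> vu; apply: ufix; rewrite -vu.
by apply: he; rewrite (normC hK) (le_lt_trans uv) // hN // sw.
Qed.

(** * Orbits approaching each other *)

Definition asymptotic P Q := forall e : R, 0 < e ->
  exists2 S0 : {fset PGL2 K}, [set` S0] `<=` Gamma &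
    forall x, Gamma x -> x \notin S0 -> exists u v,
      [/\ pgl_act x P = Some u, pgl_act x Q = Some v & norm (u - v) < e].

Lemma asymptotic_trans P Q T : asymptotic P Q -> asymptotic Q T -> asymptotic P T.
Proof.
move=> hPQ hQT e e0; have [S0 S0G hS0] := hPQ e e0; have [S1 S1G hS1] := hQT e e0.
exists (S0 `|` S1)%fset; first by move=> x /=; rewrite inE => /orP[/S0G|/S1G].
move=> x Gx; rewrite inE negb_or => /andP[/(hS0 _ Gx)[u [v [Pu Qv uv]]]].
move=> /(hS1 _ Gx)[v' [t [Qv' Tt vt]]]; exists u, t; split=> //.
by apply: (dist_lt hK uv); move: Qv'; rewrite Qv => -[->].
Qed.

Lemma asymptotic_sym P Q : asymptotic P Q -> asymptotic Q P.
Proof.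
move=> hPQ e /hPQ[S0 S0G hS0]; exists S0 => // x Gx /(hS0 x Gx)[u [v [? ? uv]]].
by exists v, u; rewrite (normC hK).
Qed.

Lemma asymptotic_act P Q x : Gamma x -> asymptotic P Q ->
  asymptotic (pgl_act x P) (pgl_act x Q).
Proof.
move=> Gx hPQ e /hPQ[S0 S0G hS0]; exists [fset (y * x^-1)%g | y in S0]%fset.
  move=> _ /= /imfsetP[y /= /S0G Gy ->].
  by apply: (GammaM hgen) => //; exact: (GammaV hgen).
move=> y Gy yS0; have [||u [v]] := hS0 (y * x)%g; first exact: (GammaM hgen).
  by apply: contra yS0 => yx; apply/imfsetP; exists (y * x)%g; rewrite ?mulgK.
by rewrite !pgl_actM; exists u, v.
Qed.

Lemma cofinite_length N : exists2 S0 : {fset PGL2 K}, [set` S0] `<=` Gamma &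
  forall x, Gamma x -> x \notin S0 -> exists l w,
    [/\ reduced (l :: w), (N <= size w)%N & word_val gamma (l :: w) = x].
Proof.
exists (fset_set (words_le gamma N)).
  move=> x /=; rewrite in_fset_set; last exact: finite_words_le.
  by rewrite inE; exact: (words_le_Gamma hgen).
move=> x /(GammaP hgen)[w rw wx]; rewrite in_fset_set; last exact: finite_words_le.
move=> /negP xN; have {xN} Nw : (N < size w)%N.
  rewrite ltnNge; apply/negP => wN; apply: xN; rewrite inE.
  by exists w.
by case: w rw wx Nw => // l w rw wx Nw; exists l, w.
Qed.

Lemma asymptotic_in_F P Q : in_F P -> in_F Q -> asymptotic P Q.
Proof.
move=> PF QF e e0; have [N hN] := ratio_small_rad e0.
have [S0 S0G hS0] := cofinite_length N; exists S0 => // x Gx /(hS0 x Gx).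
move=> [l [w [rw Nw <-]]].
have [u [v [uE vE _ _ uv]]] := word_contract rw (PF _) (QF _).
by exists u, v; split=> //; apply: le_lt_trans uv _; exact: hN.
Qed.

(** If the word does not end in [l^-1], both points avoid the relevant disc. If it does, that letter
    is split off and cancelled against [l], and the shorter word is applied to [l^-1 P] and [P]. *)
Lemma asymptotic_letter l P : in_F P -> asymptotic P (act l P).
Proof.
move=> PF e e0; have [N hN] := ratio_small_rad e0.
(* One letter more than [N], since the cancellation may cost one. *)
have [S0 S0G hS0] := cofinite_length N.+1; exists S0 => // x Gx /(hS0 x Gx).
move=> [h [w [rw Nw <-]]].
have out k k' Q : in_closed k Q -> k' != k -> ~~ in_open k' Q.
  by move=> kQ; apply: contra => /in_openW/in_closed_inj/(_ kQ) ->.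
have [lw|lw] := eqVneq (last h w) (letter_inv l); last first.
  have [||u [v [uE vE _ _ uv]]] := word_contract (P := P) (Q := act l P) rw.
  - exact: PF.
  - apply: (out l); first exact: act_out.
    by apply: contra lw => /eqP <-; rewrite letter_invK.
  by exists u, v; split=> //; apply: le_lt_trans uv _; apply: hN; exact: ltnW.
case/lastP: w rw Nw lw => // w k rw; rewrite size_rcons ltnS last_rcons => Nw kl.
subst k; move: rw; rewrite /reduced /= rcons_path letter_invK => /andP[rw wl].
have -> : word_val gamma (h :: rcons w (letter_inv l)) =
    (word_val gamma (h :: w) * letter_val gamma (letter_inv l))%g.
  by rewrite -rcons_cons -cats1 word_val_cat word_val1.
rewrite !pgl_actM act_letterK.
have [||u [v [uE vE _ _ uv]]] := word_contract (P := act (letter_inv l) P) (Q := P) rw.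
- apply: (out (letter_inv l)); first by apply: act_out; exact: PF.
  by apply: contra wl => /eqP/(inv_inj (@letter_invK g)) ->.
- exact: PF.
by exists u, v; split=> //; apply: le_lt_trans uv _; exact: hN.
Qed.

(** Each orbit point is joined to its point of [F] letter by letter, translating [asymptotic_letter]
    by the group. *)
Lemma asymptotic_orbit P Q x y : in_F P -> in_F Q -> Gamma x -> Gamma y ->
  asymptotic (pgl_act x P) (pgl_act y Q).
Proof.
have word T w : in_F T -> asymptotic T (wact w T).
  move=> TF; elim: w => [|l w IH].
    by rewrite /word_val big_nil pgl_act1; exact: asymptotic_in_F.
  apply: asymptotic_trans (asymptotic_letter l TF) _; rewrite wact_cons.
  by apply: asymptotic_act => //; exact: Gamma_letter hgen _.
move=> PF QF /(GammaP hgen)[w _ <-] /(GammaP hgen)[w' _ <-].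
apply: asymptotic_trans (asymptotic_sym (word _ _ PF)) _.
exact: asymptotic_trans (asymptotic_in_F PF QF) (word _ _ QF).
Qed.

(** * Distance from z to the orbit, and the product u *)

Lemma in_open_far l u z : in_F (Some z) -> in_open l (Some u) -> rad l <= norm (z - u).
Proof.
move=> zF /= ul; rewrite leNgt; apply: contra (zF l) => zu /=.
exact: (dist_lt hK zu).
Qed.

(** Words of length at least 2 put [a] into an open disc, at distance at least [d] from [z]. A
    single letter may leave [a] on a boundary; for the identity and the finitely many letters,
    positivity comes from [z] not lying in the orbit. *)
Lemma orbit_far z a : in_F (Some z) -> in_F (Some a) ->
  ~ Gorbit Gamma (Some a) (Some z) -> exists2 e, 0 < e &
  forall x, Gamma x -> exists2 u, pgl_act x (Some a) = Some u & e <= norm (z - u).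
Proof.
move=> zF aF az.
have neq x u : Gamma x -> pgl_act x (Some a) = Some u -> 0 < norm (z - u).
  move=> Gx xu; rewrite (norm_gt0 hK) subr_eq0; apply/eqP => zu.
  by apply: az; exists x; rewrite // xu zu.
have act_some l : exists u, act l (Some a) = Some u.
  by have := act_out (aF (letter_inv l)); case: (act l (Some a)) => // u; exists u.
have [e e0 he] : exists2 e, 0 < e &
    {in enum {: letter g}, forall l, e <= norm (z - aff (act l (Some a)))}.
  apply: seq_lower_bound => l; have [u lu] := act_some l; rewrite lu /=.
  by apply: neq lu; exact: Gamma_letter hgen _.
exists (Num.min d (Num.min e (norm (z - a)))).
  by rewrite !lt_min d_gt0 e0 (neq 1%g) ?pgl_act1 //; exact: Gamma1 hgen.
move=> x /(GammaP hgen)[[|l [|h w]] rw <-].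
- by exists a; rewrite ?ge_min ?lexx ?orbT // /word_val big_nil pgl_act1.
- have [u lu] := act_some l; exists u; rewrite ?wact1 //.
  by have := he l (mem_enum _ _); rewrite lu !ge_min => /= ->; rewrite orbT.
- have := word_out_open rw (aF _); case: (wact _ _) => // u ul; exists u => //.
  by rewrite ge_min (le_trans (d_le l)) // in_open_far.
Qed.

(** [asymptotic] requires both points to be finite, so the placeholder value of [aff] can only occur
    in the finite exceptional set. *)
Lemma asymptotic_tends P Q : asymptotic P Q ->
  tends norm Gamma (fun x => aff (pgl_act x P) - aff (pgl_act x Q)) 0.
Proof.
move=> hPQ e /hPQ[S0 S0G hS0]; exists S0 => // x Gx /(hS0 x Gx)[u [v [-> -> uv]]].
by rewrite subr0.
Qed.

Lemma orbit_diff_tends alpha a : Gamma alpha -> in_F (Some a) ->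
  tends norm Gamma (fun x => aff (pgl_act x (Some a)) -
    aff (pgl_act (x * alpha)%g (Some a))) 0.
Proof.
move=> Galpha aF r r0.
have [S0 S0G hS0] :=
  asymptotic_tends (asymptotic_orbit aF aF (Gamma1 hgen) Galpha) r0.
exists S0 => // x Gx xS0; have := hS0 x Gx xS0.
by rewrite pgl_act1 pgl_actM.
Qed.

(* The factors at [b] are those at [a] times [h y / h (y * alpha)], where
   [h y = (z - y b) / (z - y a)] tends to 1; both products of [h] agree after
   reindexing by [alpha]. *)
Lemma has_prod_u alpha a z e : Gamma alpha -> in_F (Some a) -> 0 < e ->
  (forall x, Gamma x -> exists2 u, pgl_act x (Some a) = Some u & e <= norm (z - u)) ->
  has_prod norm Gamma
    (fun x => (z - aff (pgl_act x (Some a))) / (z - aff (pgl_act (x * alpha)%g (Some a))))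
    (u_ norm Gamma alpha z).
Proof.
move=> Galpha aF e0 far; pose X x := aff (pgl_act x (Some a)).
have GX x : Gamma x -> Gamma (x * alpha)%g by move=> Gx; exact: GammaM hgen _ _ Gx Galpha.
have GXV x : Gamma x -> Gamma (x * alpha^-1)%g.
  by move=> Gx; apply: (GammaM hgen) => //; exact: GammaV hgen _ Galpha.
have farX x : Gamma x -> e <= norm (z - X x).
  by move=> /far[u xu zu]; rewrite /X xu.
have zsubX x : Gamma x -> zsub z (pgl_act x (Some a)) = z - X x.
  by move=> /far[u xu _]; rewrite /X xu.
have X0 x : Gamma x -> z - X x != 0.
  by move=> Gx; rewrite -(norm_gt0 hK) (lt_le_trans e0) ?farX.
have [x Gx|v v0 hv] := has_prod_ex hK _ (quotient_tends1 hK e0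
    (fun x Gx => farX _ (GX x Gx)) (orbit_diff_tends Galpha aF)).
  by apply: mulf_neq0; rewrite ?invr_eq0; [exact: X0|exact: X0 (GX _ Gx)].
have az : ~ Gorbit Gamma (Some a) (Some z).
  move=> [x Gx xz]; have [u xu] := far x Gx; move: xz; rewrite xu => -[->].
  by rewrite subrr (norm0 hK) leNgt e0.
(* It is enough that [v] serves for all admissible [b]: the value selected by [xget] then does so
   too, and [b = a] gives the claim. *)
suff hall : forall b, Omega norm Gamma b -> ~ Gorbit Gamma b (Some z) ->
    has_prod norm Gamma
      (fun y => zsub z (pgl_act y b) / zsub z (pgl_act (y * alpha)%g b)) v.
  rewrite /u_; case: xgetP => [v' _ hv'|/(_ v)//].
  have := hv' (Some a) (in_F_Omega aF) az; apply: has_lim_ext => S SG.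
  by apply: eq_big_seq => x /SG Gx; rewrite (zsubX _ Gx) (zsubX _ (GX _ Gx)).
move=> b /Omega_cover[x0 Gx0 [Q QF ->]] {b}; set b := pgl_act x0 Q => bz.
have b0 x : Gamma x -> zsub z (pgl_act x b) != 0.
  move=> Gx; case E: (pgl_act x b) => [u|] /=; last exact: oner_neq0.
  by rewrite subr_eq0; apply/eqP => zu; apply: bz; exists x => //; rewrite E zu.
pose h x := zsub z (pgl_act x b) / (z - X x).
have h1 : tends norm Gamma h 1.
  move=> r r0; have ab := asymptotic_orbit QF aF Gx0 (Gamma1 hgen).
  have [S0 S0G hS0] := ab _ (mulr_gt0 r0 e0); exists S0 => // x Gx xS0.
  have [u [v' [bu av' uv']]] := hS0 x Gx xS0; rewrite pgl_act1 in av'.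
  have := X0 x Gx; have := farX x Gx; rewrite /h /X bu av' /= => ev' v'0.
  have -> : (z - u) / (z - v') - 1 = - (u - v') / (z - v') by field.
  rewrite (normM hK) (normN hK) (normV hK) ltr_pdivrMr ?(norm_gt0 hK) //.
  by apply: lt_le_trans uv' _; rewrite ler_wpM2l // ltW.
have [x Gx|H H0 hH] := has_prod_ex hK _ h1.
  by apply: mulf_neq0; rewrite ?invr_eq0; [exact: b0|exact: X0].
have hH' := has_prod_reindex (mulgK alpha) (mulgVK alpha) GX GXV hH.
have := has_limM hK (has_limM hK hv hH) (has_limV hK H0 hH').
rewrite mulfK //; apply: has_lim_ext => S SG.
rewrite -prodfV -!big_split /=; apply: eq_big_seq => x /SG Gx; rewrite /h -!/(X _).
by field; rewrite (X0 _ Gx) (X0 _ (GX _ Gx)) (b0 _ (GX _ Gx)).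
Qed.

(** * Terms outside Gamma_m *)

Lemma ratio_expE m : p%:R `^ (- (m%:R * c) - logp p d) = ratio ^+ m / d.
Proof.
have p0 : 0 < (p%:R : R) := lt_trans ltr01 (p_gt1 R hp).
rewrite powRD; last by rewrite (gt_eqF p0) /= implybT.
rewrite (powRN _ (logp p d)) logp_powR ?d_gt0 // -mulrN [m%:R * _]mulrC powRrM powR_mulrn //.
Qed.

(** Both [a] and [gamma_i a] lie in [F]. The word has at least two letters, so it sends them into
    the open disc of [l], and both factors of the denominator are at least [rad l]; one [rad l]
    cancels against the numerator, the other is at least [d]. *)
Lemma tail_term_le l w m a z i : reduced (l :: w) -> (0 < size w)%N -> (m <= size w)%N ->
  in_F (Some z) -> in_F (Some a) -> in_closed (i, true) (Some a) ->
  let x := word_val gamma (l :: w) in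
  norm ((aff (pgl_act x (Some a)) - aff (pgl_act (x * gamma i)%g (Some a))) /
    ((z - aff (pgl_act x (Some a))) * (z - aff (pgl_act (x * gamma i)%g (Some a)))))
  <= ratio ^+ m / d.
Proof.
case: w => // h w rw _ mw zF aF ai; rewrite /= pgl_actM.
have bF := @in_F_act_boundary (i, false) _ aF ai; rewrite /letter_val /= in bF.
have := word_contract rw (aF _) (bF _).
have := word_out_open rw (aF _); have := word_out_open rw (bF _).
move=> + + [u [v [uE vE _ _ uv]]]; rewrite uE vE.
move=> /(in_open_far zF) zv /(in_open_far zF) zu.
have l0 := rad_gt0 l; have r0 := ratio_gt0.
have zu0 := lt_le_trans l0 zu; have zv0 := lt_le_trans l0 zv.
rewrite (normM hK) (normV hK) (normM hK) /= ler_pdivrMr ?mulr_gt0 //.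
apply: (le_trans uv).
apply: (@le_trans _ _ (ratio ^+ m / d * (rad l * rad l))); last first.
  rewrite ler_wpM2l ?divr_ge0 ?exprn_ge0 ?(ltW r0) ?(ltW d_gt0) //.
  by rewrite ler_pM ?(ltW l0).
rewrite mulrA [X in _ <= X]mulrC ler_wpM2l ?(ltW l0) //.
apply: (@le_trans _ _ (ratio ^+ m)).
  by apply: ler_wiXn2l; rewrite ?(ltW r0) ?(ltW ratio_lt1).
rewrite -mulrA ler_peMr ?exprn_ge0 ?(ltW r0) //.
by rewrite mulrC ler_pdivlMr ?d_gt0 // mul1r d_le.
Qed.

End Group.

End PingPong.

(** * The truncation error *)

Theorem proposition3p14 (R : realType) (p : nat) (hp : prime p)
    (K : fieldType) (norm : K -> R) (hK : is_Cp p norm)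
    (Gamma : set (PGL2 K)) (hGamma : schottky norm Gamma)
    (g : nat) (gamma : 'I_g -> PGL2 K) (hgamma : free_generators Gamma gamma)
    (B B' : 'I_g -> oball R K) (hF : good_fdomain norm gamma B B')
    (hoo : fdomain_int norm B B' None)
    (c : R)
    (hc : is_min [set x | exists s t : 'I_g + 'I_g, s != t /\
            x = bdist p norm (bpt (sides B B' s)) (bpt (sides B B' t))] c)
    (d : R) (hd : is_min ([set bradius (sides B B' s) | s in setT]) d)
    (m : nat) (hm : (1 <= m)%N) (i : 'I_g)
    (a : P1 K) (ha : (cls norm (B' i) `\` opn norm (B' i)) a)
    (z : K) (hz : fdomain norm B B' (Some z)) (hza : ~ Gorbit Gamma a (Some z)) :
  norm (\sum_(y \in words_le gamma m)
          (aff (pgl_act y a) - aff (pgl_act (y * gamma i)%g a)) /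
          ((z - aff (pgl_act y a)) * (z - aff (pgl_act (y * gamma i)%g a)))
        - derivative norm (u_ norm Gamma (gamma i)) z
          / u_ norm Gamma (gamma i) z)
    <= p%:R `^ (- (m%:R * c) - logp p d).
Proof.
have hgen := hgamma.1; have Gi : Gamma (gamma i) := Gamma_letter hgen (i, false).
have d0 := d_gt0 hF hd.
have zF := (fdomainE hoo _).1 hz.
case: ha => /(clsE hoo (i, true)) ai /(opnE hoo (i, true)) ai'.
(* The open discs other than [B_i'] miss [a] because the closed discs are disjoint. *)
have aF : in_F norm B B' a.
  move=> l; apply/negP => la.
  have := in_closed_inj hF hoo (in_openW la) ai => li; subst l.
  exact: ai'.
case: a ai ai' hza aF => // a ai ai' hza aF.
have [e e0 far] := orbit_far hp hK hF hoo hc hgamma hd zF aF hza.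
have farX x : Gamma x -> e <= norm (z - aff (pgl_act x (Some a))).
  by move=> /far[u -> zu].
have GX x : Gamma x -> Gamma (x * gamma i)%g by move=> Gx; exact: GammaM hgen _ _ Gx Gi.
(* A shift of [z] by less than [e] keeps all distances to the orbit, so the product formula holds on
   a neighbourhood, as differentiation needs. *)
have hu z' : norm (z' - z) < e -> has_prod norm Gamma
    (fun x => (z' - aff (pgl_act x (Some a))) / (z' - aff (pgl_act (x * gamma i)%g (Some a))))
    (u_ norm Gamma (gamma i) z').
  move=> zz'; apply: (has_prod_u hp hK hF hoo hc hGamma hgamma hd Gi aF e0) => x Gx.
  have [u xu zu] := far x Gx; exists u => //; rewrite (@norm_near _ _ _ _ hK (z - u)) //.
  have -> : z' - u - (z - u) = z' - z by ring.
  exact: lt_le_trans zz' zu.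
have XY := orbit_diff_tends hp hK hF hoo hc hgamma Gi aF.
have farY x (Gx : Gamma x) := farX _ (GX x Gx).
have [L hL dL] := log_derivative hK e0 farX farY XY hu.
have u0 := log_derivative_neq0 hK e0 farX farY XY hu.
rewrite (derivativeE hp hK dL) mulrAC divff // mul1r (normC hK).
have finW := finite_words_le gamma m.
rewrite fsbig_finite //; set W := fset_set _.
have WG : [set` W] `<=` Gamma.
  by move=> x /=; rewrite in_fset_set // inE; exact: (words_le_Gamma hgen).
have ratio0 := ratio_gt0 hp c; rewrite (ratio_expE hp hF c hd).
(* The error is a limit of partial sums minus the sum over [Gamma_m]; for finite sets containing
   [Gamma_m] only terms outside it remain. *)
apply: (has_lim_le hK (has_limB hK hL (has_lim_cst hK Gamma _))).
apply: eventuallyS (eventually_sup WG) => S SG WS.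
rewrite (big_fsetD _ _ WS) /= addrAC subrr add0r big_seq.
apply: (norm_sum hK) => [|x]; first by rewrite divr_ge0 ?exprn_ge0 // ltW.
rewrite !inE => /andP[xW /SG /(GammaP hgen)[w rw wx]].
have mw : (m < size w)%N.
  rewrite ltnNge; apply: contra xW => wm; rewrite in_fset_set // inE.
  by exists w.
case: w rw wx mw => // l w rw <- mw.
(* More than [m >= 1] letters means at least two, with at least [m] after the first. *)
by apply: (tail_term_le hp hK hF hoo hc hd) => //; exact: leq_trans hm mw.
Qed.
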